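(* Let $\Omega\subseteq\mathbb{R}^n$ be a bounded open set with Lipschitz boundary. Let $\underline{u}$ and $\overline{u}$ be respectively a subminimizer and a superminimizer of $\mathcal{F}$ in $\Omega$. If $\underline{u}\le\overline{u}$ a.e. in $\mathbb{R}^n\setminus\Omega$, then $\underline{u}\le\overline{u}$ a.e. in $\mathbb{R}^n$.
   Context: $n\ge1$ is an integer, $s\in(0,1)$, and $g:\mathbb{R}\to(0,1]$ is an even continuous function with $\int_{\mathbb{R}}g(t)|t|\,dt<\infty$. Set $G(t):=\int_0^t g(\tau)\,d\tau$ and $\mathcal{G}(t):=\int_0^t G(\tau)\,d\tau$. $Q(\Omega):=\mathbb{R}^{2n}\setminus(\mathbb{R}^n\setminus\Omega)^2$; $\mathcal{W}^s(\Omega):=\{u:\mathbb{R}^n\to\mathbb{R}\text{ measurable}: u|_\Omega\in W^{s,1}(\Omega)\}$, where $W^{s,1}(\Omega)$ is the space of $u\in L^1(\Omega)$ with $\int_\Omega\int_\Omega\frac{|u(x)-u(y)|}{|x-y|^{n+s}}\,dx\,dy<\infty$. A measurable $u:\mathbb{R}^n\to\mathbb{R}$ is a subminimizer (resp. superminimizer) of $\mathcal{F}$ in $\Omega$ if $u\in\mathcal{W}^s(\Omega)$ and $$\iint_{Q(\Omega)}\left\{\mathcal{G}\left(\frac{u(x)-u(y)}{|x-y|}\right)-\mathcal{G}\left(\frac{v(x)-v(y)}{|x-y|}\right)\right\}\frac{dx\,dy}{|x-y|^{n-1+s}}\le0$$ for every $v\in\mathcal{W}^s(\Omega)$ such that $v=u$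 a.e. in $\mathbb{R}^n\setminus\Omega$ and $v\le u$ (resp. $v\ge u$) a.e. in $\Omega$. (The integral converges absolutely for all such $u,v$.) *)

(* Defs.v *)
From HB Require Import structures.
From mathcomp Require Import all_boot all_order all_algebra.
From mathcomp Require Import all_classical all_reals all_analysis.
From mathcomp Require Import lra.

Set Implicit Arguments.
Unset Strict Implicit.
Unset Printing Implicit Defensive.

Import Order.TTheory GRing.Theory Num.Theory.
Import numFieldNormedType.Exports.

Local Open Scope classical_set_scope.
Local Open Scope ring_scope.

Section euclidean_space.
Context {R : realType} {n : nat}.
Implicit Types x y a b : 'rV[R]_n.

Definition dotv x y : R := \sum_i x ord0 i * y ord0 i.

(* The library norm `|x| on 'rV[R]_n is the sup norm. *)
Definition enorm x : R := Num.sqrt (dotv x x).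

Definition box a b : set 'rV[R]_n :=
  [set x | forall i, a ord0 i <= x ord0 i <= b ord0 i].

Definition box_vol a b : R := \prod_i Num.max (b ord0 i - a ord0 i) 0.

(* Countable covers are indexed by a subset D of nat, so that finite and empty
   covers are allowed: in dimension 0 every box is nonempty and has volume 1. *)
Definition box_cover (A : set 'rV[R]_n)
    (C : set nat * (nat -> 'rV[R]_n * 'rV[R]_n)) :=
  A `<=` \bigcup_(k in C.1) box (C.2 k).1 (C.2 k).2.

Definition cover_vol (C : set nat * (nat -> 'rV[R]_n * 'rV[R]_n)) : \bar R :=
  (\esum_(k in C.1) (box_vol (C.2 k).1 (C.2 k).2)%:E)%E.

(* Lebesgue (outer) measure on R^n; its Caratheodory sigma-algebra, which is the
   sigma-algebra of Lebesgue measurable sets, is put on 'rV[R]_n below. *)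
Definition lebesgueN (A : set 'rV[R]_n) : \bar R :=
  ereal_inf (cover_vol @` box_cover A).

Lemma box_vol_ge0 a b : 0 <= box_vol a b.
Proof. by apply: prodr_ge0 => i _; rewrite le_max lexx orbT. Qed.

Lemma cover_vol_ge0 C : (0 <= cover_vol C)%E.
Proof. by apply: esum_ge0 => k _; rewrite lee_fin box_vol_ge0. Qed.

Lemma lebesgueN_ge0 A : (0 <= lebesgueN A)%E.
Proof. by apply: le_ereal_inf_tmp => _ [C _ <-]; exact: cover_vol_ge0. Qed.

Lemma lebesgueN_le_cover A C : box_cover A C -> (lebesgueN A <= cover_vol C)%E.
Proof. by move=> AC; apply: ereal_inf_lbound; exists C. Qed.

Lemma lebesgueN0 : lebesgueN set0 = 0%E.
Proof.
apply/eqP; rewrite eq_le lebesgueN_ge0 andbT.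
have /lebesgueN_le_cover/le_trans -> // : box_cover set0 (set0, fun=> (0, 0)).
  by move=> ? [].
by rewrite /cover_vol esum_set0.
Qed.

Lemma le_lebesgueN : {homo lebesgueN : A B / A `<=` B >-> (A <= B)%E}.
Proof.
move=> A B AB; apply: ereal_inf_le_tmp => _ [C BC <-]; exists C => //.
exact: subset_trans BC.
Qed.

Lemma lebesgueN_sigma_subadditive : sigma_subadditive lebesgueN.
Proof.
move=> A; have [[i ioo]|] := pselect (exists i, lebesgueN (A i) = +oo%E).
  by rewrite (eseries_pinfty _ _ ioo) ?leey// => k _;
    rewrite -ltNye (lt_le_trans _ (lebesgueN_ge0 _)).
rewrite -forallNE => Aoo.
apply/lee_addgt0Pr => e e0.
rewrite (le_trans _ (epsilon_trick _ _ (ltW e0)))//; last first.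
  by move=> k; exact: lebesgueN_ge0.
have [C CP] : {C & forall k, box_cover (A k) (C k) /\
    (cover_vol (C k) <= lebesgueN (A k) + (e / (2 ^ k.+1)%:R)%:E)%E}.
  apply: (@choice _ _ (fun k C => box_cover (A k) C /\
    (cover_vol C <= lebesgueN (A k) + (e / (2 ^ k.+1)%:R)%:E)%E)) => k.
  have fk : lebesgueN (A k) \is a fin_num.
    by rewrite ge0_fin_numE ?lebesgueN_ge0// ltey; apply/eqP/Aoo.
  have ek : 0 < e / (2 ^ k.+1)%:R :> R by rewrite divr_gt0// ltr0n expn_gt0.
  have /= [_ [C AC <-] /ltW CA] := lb_ereal_inf_adherent ek fk.
  by exists C.
pose P := [set: nat] `*`` (fun k => (C k).1).
pose E j := oapp (fun p : nat * nat => (C p.1).2 p.2) (0, 0)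
  (unpickle j : option (nat * nat)).
have EK (p : nat * nat) : E (pickle p) = (C p.1).2 p.2 by rewrite /E pickleK.
have cP : box_cover (\bigcup_k A k) (pickle @` P, E).
  move=> x [k _ /(CP k).1[j Cj xj]]; exists (pickle (k, j)).
    by exists (k, j).
  by rewrite /= EK.
apply: (le_trans (lebesgueN_le_cover cP)).
rewrite /cover_vol/= (@reindex_esum R _ _ P _ pickle); last first.
  split => [p Pp|p q _ _|_ [p Pp <-]]; [by exists p| |by exists p].
  exact: (pcan_inj pickleK).
under eq_esum do rewrite EK.
rewrite -(@esum_esum _ _ _ _ _ (fun k j =>
  (box_vol ((C k).2 j).1 ((C k).2 j).2)%:E)); last first.
  by move=> *; rewrite lee_fin box_vol_ge0.
rewrite nneseries_esumT; last first.
  by move=> k; rewrite adde_ge0 ?lebesgueN_ge0// lee_fin divr_ge0// ltW.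
by apply: le_esum => k _; exact: (CP k).2.
Qed.

HB.instance Definition _ := isOuterMeasure.Build R _ lebesgueN
  lebesgueN0 lebesgueN_ge0 le_lebesgueN lebesgueN_sigma_subadditive.

End euclidean_space.

HB.instance Definition _ (R : realType) (n : nat) :=
  @isMeasurable.Build (caratheodory_display (@lebesgueN R n)) 'rV[R]_n
    (@lebesgueN R n).-caratheodory
    (caratheodory_measurable_set0 (@lebesgueN R n))
    (@caratheodory_measurable_setC _ _ (@lebesgueN R n))
    (@caratheodory_measurable_bigcup _ _ (@lebesgueN R n)).

HB.instance Definition _ (R : realType) (n : nat) :=
  isMeasure.Build _ _ _ (@lebesgueN R n)
    (outer_measure0 (@lebesgueN R n)) (outer_measure_ge0 (@lebesgueN R n))
    (@caratheodory_measure_sigma_additive _ _ (@lebesgueN R n)).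

Lemma lebesgueN_halfspace (R : realType) (n : nat) (i : 'I_n) (c : R) :
  measurable [set x : 'rV[R]_n | x ord0 i <= c].
Proof.
apply: le_caratheodory_measurable => X.
apply: le_ereal_inf_tmp => _ [C XC <-].
pose C1 := (C.1, fun k => ((C.2 k).1,
  \row_j (if j == i then Num.min ((C.2 k).2 ord0 j) c else (C.2 k).2 ord0 j))).
pose C2 := (C.1, fun k =>
  (\row_j (if j == i then Num.max ((C.2 k).1 ord0 j) c else (C.2 k).1 ord0 j),
  (C.2 k).2)).
have XC1 : box_cover (X `&` [set x | x ord0 i <= c]) C1.
  move=> x [/XC[k Ck xk] /= xc]; exists k => //= j; rewrite mxE.
  by have := xk j; case: eqP => [->|//]; rewrite le_min xc andbT.
have XC2 : box_cover (X `&` ~` [set x | x ord0 i <= c]) C2.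
  move=> x [/XC[k Ck xk] /= /negP]; rewrite -ltNge => /ltW cx.
  exists k => //= j; rewrite mxE.
  by have := xk j; case: eqP => [->|//]; rewrite ge_max cx andbT.
apply: (le_trans (leeD (lebesgueN_le_cover XC1) (lebesgueN_le_cover XC2))).
rewrite /cover_vol -esumD; [|by move=> *; rewrite lee_fin box_vol_ge0..].
apply: le_esum => k _ /=; rewrite -EFinD lee_fin /box_vol.
rewrite [X in X + _](bigD1 i)// [X in _ + X](bigD1 i)// [leRHS](bigD1 i)//=.
rewrite !mxE eqxx.
set a := (C.2 k).1; set b := (C.2 k).2.
under [X in _ * X + _]eq_bigr => j /negbTE ji do rewrite mxE ji.
under [X in _ + _ * X]eq_bigr => j /negbTE ji do rewrite mxE ji.
rewrite -mulrDl ler_wpM2r//.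
  by apply: prodr_ge0 => j _; rewrite le_max lexx orbT.
rewrite /Num.max /Num.min; do ?case: ifPn; rewrite -?leNgt; lra.
Qed.

Lemma measurable_box (R : realType) (n : nat) (a b : 'rV[R]_n) :
  measurable (box a b).
Proof.
have opp c i : measurable [set x : 'rV[R]_n | c <= x ord0 i].
  rewrite [X in measurable X](_ : _ =
      ~` \bigcup_k [set x : 'rV[R]_n | x ord0 i <= c - k.+1%:R^-1]).
    apply: measurableC; apply: bigcup_measurable => k _.
    exact: lebesgueN_halfspace.
  apply/seteqP; split => x /=.
    move=> cx [k _ /= /(le_trans cx)]; rewrite leNgt => /negP; apply.
    by rewrite ltrBlDr ltrDl invr_gt0.
  move=> nx; rewrite leNgt; apply/negP => xc; apply: nx.
  have cx0 : 0 < c - x ord0 i by rewrite subr_gt0.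
  have [k _ /(_ k (leqnn _)) /ltW] := near_infty_natSinv_lt (PosNum cx0).
  by move=> /= kcx; exists k => //=; rewrite lerBrDl -lerBrDr.
rewrite [X in measurable X](_ : _ = \bigcap_(i in [set: 'I_n])
    ([set x : 'rV[R]_n | a ord0 i <= x ord0 i] `&` [set x | x ord0 i <= b ord0 i])).
  apply: fin_bigcap_measurable => // i _.
  by apply: measurableI; [exact: opp|exact: lebesgueN_halfspace].
apply/seteqP; split => [x xab i _/=|x xab i]; first exact/andP/xab.
exact/andP/xab.
Qed.

Lemma lebesgueN_box_le (R : realType) (n : nat) (a b : 'rV[R]_n) :
  (lebesgueN (box a b) <= (box_vol a b)%:E)%E.
Proof.
have /lebesgueN_le_cover : box_cover (box a b) ([set 0%N], fun=> (a, b)).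
  by move=> x; exists 0%N.
by rewrite /cover_vol/= esum_set1// lee_fin box_vol_ge0.
Qed.

Lemma lebesgueN_sigma_finite (R : realType) (n : nat) :
  sigma_finite setT (@lebesgueN R n).
Proof.
pose q k : 'rV[R]_n := const_mx k%:R.
exists (fun k => box (- q k) (q k)); last first.
  move=> k; split; first exact: measurable_box.
  exact: le_lt_trans (lebesgueN_box_le _ _) (ltry _).
apply/esym/seteqP; split => // x _.
exists (Num.truncn `|x|).+1 => // i; rewrite !mxE -ler_norml.
apply: (@le_trans _ _ `|x|); last exact/ltW/truncnS_gt.
rewrite [leRHS]/Num.norm/= mx_normrE; apply/bigmax_geP; right => /=.
by exists (ord0, i).
Qed.

HB.instance Definition _ (R : realType) (n : nat) :=
  Measure_isSigmaFinite.Build _ _ _ (@lebesgueN R n)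
    (@lebesgueN_sigma_finite R n).


Section lipschitz_domain.
Context {R : realType} {n : nat}.
Implicit Types W : set 'rV[R]_n.

Definition boundary W : set 'rV[R]_n := closure W `\` W°.

(* Near each boundary point p, W is the strict epigraph of a Lipschitz function
   in a rotated Cartesian frame whose last axis is spanned by the unit vector e:
   dotv x e is the last coordinate of x, x - dotv x e *: e collects the n - 1
   others, and phi is only used on the hyperplane orthogonal to e, a copy of
   R^(n-1). *)
Definition lipschitz_boundary W :=
  forall p, boundary W p ->
  exists (r L : R) (e : 'rV[R]_n) (phi : 'rV[R]_n -> R),
    [/\ 0 < r, enorm e = 1,
        forall y z, dotv y e = 0 -> dotv z e = 0 ->
          `|phi y - phi z| <= L * enorm (y - z) &
        forall x, enorm (x - p) < r ->
          (W x <-> phi (x - dotv x e *: e) < dotv x e)].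

End lipschitz_domain.

Section fractional_functional.
Context {R : realType}.

(* The oriented integral of f from 0 to t. *)
Definition int0 (f : R -> R) (t : R) : R :=
  if 0 <= t then \int[lebesgue_measure]_(x in `[0, t]) f x
  else - \int[lebesgue_measure]_(x in `[t, 0]) f x.

Context {n : nat}.
Implicit Types (s : R) (g : R -> R) (W : set 'rV[R]_n) (u v : 'rV[R]_n -> R).

Definition Qset W : set ('rV[R]_n * 'rV[R]_n) := ~` (~` W `*` ~` W).

Definition sobolev_Ws1 s W u :=
  lebesgueN.-integrable W (EFin \o u) /\
  (\int[lebesgueN]_(x in W) \int[lebesgueN]_(y in W)
     (`|u x - u y| / enorm (x - y) `^ (n%:R + s))%:E < +oo)%E.

Definition Wspace s W u := measurable_fun setT u /\ sobolev_Ws1 s W u.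

(* On the diagonal the quotients take the value 0, from 0^-1 = 0; the diagonal is
   a null set of R^n x R^n. *)
Definition energy_gap g s W u v : \bar R :=
  (\int[lebesgueN \x lebesgueN]_(z in Qset W)
     ((int0 (int0 g) ((u z.1 - u z.2) / enorm (z.1 - z.2)) -
       int0 (int0 g) ((v z.1 - v z.2) / enorm (z.1 - z.2))) /
      enorm (z.1 - z.2) `^ (n%:R - 1 + s))%:E)%E.

Definition subminimizer g s W u :=
  Wspace s W u /\
  forall v, Wspace s W v ->
    {ae lebesgueN, forall x, (~` W) x -> v x = u x} ->
    {ae lebesgueN, forall x, W x -> v x <= u x} ->
    (energy_gap g s W u v <= 0)%E.

Definition superminimizer g s W u :=
  Wspace s W u /\
  forall v, Wspace s W v ->
    {ae lebesgueN, forall x, (~` W) x -> v x = u x} ->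
    {ae lebesgueN, forall x, W x -> u x <= v x} ->
    (energy_gap g s W u v <= 0)%E.

End fractional_functional.

(* Main.v *)
Require Import Defs.
From mathcomp Require Import all_boot all_order all_algebra.
From mathcomp Require Import all_classical all_reals all_analysis.
From mathcomp Require Import measurable_realfun ring lra.

Set Implicit Arguments.
Unset Strict Implicit.
Unset Printing Implicit Defensive.

Import Order.TTheory GRing.Theory Num.Theory.
Import numFieldNormedType.Exports.

Local Open Scope classical_set_scope.
Local Open Scope ring_scope.

(* Let u be the subminimizer, w the superminimizer and psi half of (u - w)^+
   truncated at 1.  The competitors u - psi and w + psi are admissible, and strict
   convexity makes the sum of the two gap integrands nonnegative, and positive
   where psi(x) <> psi(y).  Both integrands are dominated by
   |psi(x) - psi(y)| / |x - y|^(n+s), which is integrable on Q(Omega): on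
   Omega x Omega since u and w lie in W^{s,1}, and on the rest since
   |psi(x) - psi(y)| <= 1 and a bounded Lipschitz set has finite s-perimeter.
   Hence psi(x) = psi(y) a.e. in Q(Omega), and as psi = 0 a.e. outside Omega, psi
   vanishes a.e.

   The s-perimeter is finite because the points of Omega within distance t of the
   complement have measure O(t): near a boundary point they lie in a slab of
   height O(t) above a Lipschitz graph, of which about 1/t disjoint translates fit
   in a ball.  A dyadic decomposition of |x - y| turns the integral into
   geometric series. *)

(** * Primitives of continuous functions *)

Section oriented_integral.
Context {R : realType}.
Implicit Types (f g : R -> R) (a b t h K : R).
Notation mu := (@lebesgue_measure R).

Lemma continuous_integrable_itv f a b : continuous f ->
  mu.-integrable `[a, b] (EFin \o f).
Proof.
move=> cf; apply: continuous_compact_integrable; first exact: segment_compact.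
exact: continuous_subspaceT.
Qed.

Lemma Rintegral_itv_split f a b c : continuous f -> a <= c -> c <= b ->
  \int[mu]_(x in `[a, b]) f x =
  \int[mu]_(x in `[a, c]) f x + \int[mu]_(x in `[c, b]) f x.
Proof.
move=> cf ac cb; apply/eqP; rewrite addrC -subr_eq; apply/eqP.
rewrite Rintegral_itvB//; last exact: continuous_integrable_itv.
apply: Rintegral_itv_obnd_cbnd.
apply: (integrableS _ _ _ (continuous_integrable_itv c b cf)) => //.
by apply: subset_itvr; rewrite bnd_simp.
Qed.

(** A base point [a] to the left of both 0 and [t] removes the case split on the sign of [t],
    leaving a primitive to which the fundamental theorem of calculus applies. *)
Lemma int0_itv f a t : continuous f -> a <= 0 -> a <= t ->
  int0 f t = \int[mu]_(x in `[a, t]) f x - \int[mu]_(x in `[a, 0]) f x.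
Proof.
move=> cf a0 at_; rewrite /int0; case: ifPn => [t0|].
  by rewrite (Rintegral_itv_split cf a0 t0) addrAC subrr add0r.
rewrite -ltNge => /ltW t0.
by rewrite (Rintegral_itv_split cf at_ t0) opprD addrA subrr add0r.
Qed.

Lemma is_derive_int0 f t : continuous f -> is_derive t (1 : R) (int0 f) (f t).
Proof.
move=> cf; pose a : R := - (`|t| + 1).
have a0 : a <= 0 by rewrite oppr_le0 addr_ge0.
have at_ : a < t.
  by rewrite /a ltrNl -normrN (le_lt_trans (ler_norm _))// ltrDl.
have [] := @continuous_FTC1_closed R f a t (t + 1) _ _ at_ (cf t).
- by rewrite ltrDl.
- exact: continuous_integrable_itv.
set F := fun x => _ => dF; rewrite derive1E => F'.
apply: (@near_eq_is_derive _ _ _ (F - cst (F 0))).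
  near=> x; rewrite (@int0_itv f a)//.
  by apply: ltW; near: x; exact: lt_nbhsr.
have -> : f t = f t - 0 by rewrite subr0.
apply: is_deriveB.
exact: (DeriveDef dF F').
Unshelve. all: by end_near. Qed.

Lemma continuous_int0 f : continuous f -> continuous (int0 f).
Proof.
move=> cf t; apply: differentiable_continuous; apply/derivable1_diffP.
by case: (is_derive_int0 t cf).
Qed.

Lemma int0_MVT f a b : continuous f -> a < b ->
  exists2 c, a < c < b & int0 f b - int0 f a = f c * (b - a).
Proof.
move=> cf ab.
have [|c|c] := @MVT R (int0 f) f a b ab.
- by move=> x _; exact: is_derive_int0.
- by apply: continuous_subspaceT; exact: continuous_int0.
- by rewrite in_itv/= => cab E; exists c.
Qed.

Lemma int0_lipschitz f K a b : continuous f -> (forall t, `|f t| <= K) ->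
  `|int0 f a - int0 f b| <= K * `|a - b|.
Proof.
move=> cf fK; wlog ab : a b / a < b.
  move=> H; have [/H//|/H|->] := ltgtP a b.
    by rewrite distrC (distrC b).
  by rewrite !subrr normr0 mulr0.
rewrite distrC (distrC a).
have [c _ ->] := int0_MVT cf ab.
by rewrite normrM ler_wpM2r.
Qed.

Lemma int0_increasing f a b : continuous f -> (forall t, 0 < f t) ->
  a < b -> int0 f a < int0 f b.
Proof.
move=> cf f0 ab; rewrite -subr_gt0; have [c _ ->] := int0_MVT cf ab.
by rewrite mulr_gt0// subr_gt0.
Qed.

(** The mean value theorem on []a, a + h[] and []b, b + h[]: as [a + h <= b], the two intermediate
    points are strictly ordered, and so are the values of [f] there. *)
Lemma int0_increment_lt f a b h : continuous f ->
  (forall x y, x < y -> f x < f y) -> 0 < h -> a + h <= b ->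
  int0 f (a + h) - int0 f a < int0 f (b + h) - int0 f b.
Proof.
move=> cf incf h0 ahb.
have [c /andP[_ c1] ->] : exists2 c, a < c < a + h &
    int0 f (a + h) - int0 f a = f c * (a + h - a).
  by apply: int0_MVT => //; rewrite ltrDl.
have [d /andP[d1 _] ->] : exists2 d, b < d < b + h &
    int0 f (b + h) - int0 f b = f d * (b + h - b).
  by apply: int0_MVT => //; rewrite ltrDl.
rewrite ![_ + h - _]addrAC !subrr !add0r ltr_pM2r//; apply: incf.
exact: (lt_le_trans c1 (le_trans ahb (ltW d1))).
Qed.

(* Moving two slopes towards each other without crossing strictly lowers the
   total of a strictly convex function. *)
Lemma int0_contraction_gt0 f (p q h : R) : continuous f ->
  (forall x y, x < y -> f x < f y) ->
  h != 0 -> 0 <= h -> 2 * h <= p - q ->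
  0 < int0 f p - int0 f (p - h) + (int0 f q - int0 f (q + h)).
Proof.
move=> cf incf hneq0 h0 hpq.
have h_gt0 : 0 < h by rewrite lt_neqAle eq_sym hneq0.
have := @int0_increment_lt f q (p - h) h cf incf h_gt0 ltac:(lra).
by rewrite subrK; lra.
Qed.

(** [g] is integrable, being at most 1 on [[-1, 1]] and at most g(t)|t| elsewhere, and its integral
    over any interval is bounded by the full one. *)
Lemma int0_bounded g : continuous g -> (forall t, 0 <= g t <= 1) ->
  (\int[mu]_t (g t * `|t|)%:E < +oo)%E ->
  exists K, forall t, `|int0 g t| <= K.
Proof.
move=> cg g01 mom.
have mg : measurable_fun setT g by exact: continuous_measurable_fun.
have g0 t : 0 <= g t by case/andP: (g01 t).
pose h t : R := \1_(`[-1, 1] : set R) t + g t * `|t|.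
have mgt : measurable_fun [set: R] (fun t => g t * `|t|).
  by apply: measurable_funM => //; exact: measurableT_comp.
have ih : mu.-integrable setT (EFin \o h).
  rewrite (_ : EFin \o h = (EFin \o \1_(`[-1, 1] : set R)) \+
      (EFin \o (fun t => g t * `|t|))); last by apply/funext.
  apply: integrableD => //.
    exact: (integrable_indic_itv (-1) 1 true false).
  apply/integrableP; split; first exact/measurable_EFinP.
  under eq_integral => x _ do rewrite gee0_abs ?lee_fin ?mulr_ge0//.
  exact: mom.
have ig : mu.-integrable setT (EFin \o g).
  apply: (le_integrable measurableT _ _ ih); first exact/measurable_EFinP.
  move=> t _ /=; rewrite lee_fin ger0_norm//.
  apply: le_trans (ler_norm _); rewrite /h indicE.
  have [t1|t1] := leP `|t| 1.
    rewrite mem_set/=; last by rewrite in_itv/= -ler_norml.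
    by case/andP: (g01 t) => _ /le_trans; apply; rewrite lerDl mulr_ge0.
  rewrite (le_trans (_ : _ <= g t * `|t|))//; first by rewrite ler_peMr// ltW.
  by rewrite lerDr.
have sub a b : 0 <= \int[mu]_(x in `[a, b]) g x <= \int[mu]_x g x.
  rewrite Rintegral_ge0//=.
  rewrite /Rintegral fine_le//.
  - by apply: integrable_fin_num => //; exact: continuous_integrable_itv.
  - by apply: integrable_fin_num.
  - apply: ge0_subset_integral => //=; first exact/measurable_EFinP.
    by move=> x _; rewrite lee_fin.
exists (\int[mu]_x g x) => t; rewrite /int0.
case: ifP => _; rewrite ?normrN ger0_norm; by case/andP: (sub 0 t) (sub t 0) => ? ? /andP[].
Qed.

End oriented_integral.

(** * Comparison of the sup norm with the Euclidean norm *)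

Section row_vector_norms.
Context {R : realType} {n : nat}.
Implicit Types (x y z e : 'rV[R]_n) (r t c : R).

Lemma le_mxnorm x i : `|x ord0 i| <= `|x|.
Proof.
rewrite [leRHS]/Num.norm/= mx_normrE.
by rewrite (bigD1 (ord0, i))//= le_max lexx.
Qed.

Lemma mxnorm_leP x r : 0 <= r -> (forall i, `|x ord0 i| <= r) <-> `|x| <= r.
Proof.
move=> r0; split=> [H|H i]; last exact: le_trans (le_mxnorm x i) H.
rewrite [leLHS]/Num.norm/= mx_normrE; apply: bigmax_le => // -[i j] _ /=.
by rewrite ord1.
Qed.

Lemma mxnorm_ltP x r : 0 < r -> (forall i, `|x ord0 i| < r) <-> `|x| < r.
Proof.
move=> r0; split=> [H|H i]; last exact: le_lt_trans (le_mxnorm x i) H.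
rewrite [ltLHS]/Num.norm/= mx_normrE; apply: bigmax_lt => // -[i j] _ /=.
by rewrite ord1.
Qed.

Lemma dotvv_ge0 x : 0 <= dotv x x.
Proof. by apply: sumr_ge0 => i _; rewrite -expr2 sqr_ge0. Qed.

Lemma enorm_ge0 x : 0 <= enorm x.
Proof. exact: sqrtr_ge0. Qed.

Lemma mxnorm_le_enorm x : `|x| <= enorm x.
Proof.
apply/mxnorm_leP => [|i]; first exact: enorm_ge0.
rewrite /enorm -sqrtr_sqr ler_wsqrtr// /dotv (bigD1 i)//= expr2 lerDl.
by apply: sumr_ge0 => j _; rewrite -expr2 sqr_ge0.
Qed.

Lemma normr_dotv_le x y : `|dotv x y| <= n%:R * `|x| * `|y|.
Proof.
apply: le_trans (ler_norm_sum _ _ _) _.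
apply: (@le_trans _ _ (\sum_(i < n) `|x| * `|y|)).
  by apply: ler_sum => i _; rewrite normrM ler_pM// le_mxnorm.
by rewrite sumr_const card_ord -[leLHS]mulr_natl mulrA.
Qed.

Lemma enorm_le_mxnorm x : enorm x <= n%:R * `|x|.
Proof.
have nx0 : 0 <= n%:R * `|x| by rewrite mulr_ge0.
rewrite -(ger0_norm nx0) -sqrtr_sqr ler_wsqrtr//.
apply: le_trans (ler_norm _) _; apply: le_trans (normr_dotv_le x x) _.
rewrite exprMn -mulrA -expr2 ler_wpM2r ?sqr_ge0//.
case: (n) => [|m]; first by rewrite expr0n.
by rewrite expr2 ler_peMl// ler1n.
Qed.

Lemma enorm_eq0 x : (enorm x == 0) = (x == 0).
Proof.
apply/idP/idP => [/eqP x0|/eqP ->]; first by rewrite -normr_le0 -x0 mxnorm_le_enorm.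
by rewrite eq_le enorm_ge0 (le_trans (enorm_le_mxnorm _))// normr0 mulr0.
Qed.

Lemma enormN x : enorm (- x) = enorm x.
Proof. by rewrite /enorm /dotv; under eq_bigr do rewrite !mxE mulrNN. Qed.

End row_vector_norms.

(** * Lebesgue measure of translates, balls and open sets *)

Section lebesgueN_theory.
Context {R : realType} {n : nat}.
Implicit Types (x y z a : 'rV[R]_n) (r t c : R) (A B : set 'rV[R]_n).

(** Translating the boxes of a cover keeps their volumes, which gives one inequality; translating
    back by [- a] gives the other. *)
Lemma lebesgueN_shift A a : lebesgueN [set x + a | x in A] = lebesgueN A.
Proof.
have le_shift B (b : 'rV[R]_n) : (lebesgueN [set (x + b)%R | x in B] <= lebesgueN B)%E.
  apply: le_ereal_inf_tmp => _ [C BC <-].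
  pose C' := (C.1, fun k => ((C.2 k).1 + b, (C.2 k).2 + b)).
  have BC' : box_cover [set x + b | x in B] C'.
    move=> _ [x /BC[k Ck xk] <-]; exists k => //= i; rewrite !mxE !lerD2r.
    exact: xk.
  apply: le_trans (lebesgueN_le_cover BC') _.
  rewrite /cover_vol/=; apply: le_esum => k _; rewrite lee_fin.
  rewrite /box_vol; apply: ler_prod => i _; rewrite le_max lexx orbT/=.
  by rewrite !mxE opprD addrACA subrr addr0.
apply/eqP; rewrite eq_le le_shift/=.
rewrite -[X in (lebesgueN X <= _)%E](_ : [set x - a | x in [set x + a | x in A]]%R = A).
  exact: le_shift.
apply/seteqP; split => [_ [_ [x Ax <-] <-]|x Ax]; first by rewrite addrK.
by exists (x + a); [exists x|rewrite addrK].
Qed.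

Lemma lebesgueN_ball_le x r : 0 <= r ->
  (lebesgueN [set y | `|x - y| <= r]%R <= ((2 * r) ^+ n)%:E)%E.
Proof.
move=> r0.
have sub : [set y | `|x - y| <= r] `<=` box (x - const_mx r) (x + const_mx r).
  move=> y /= /(mxnorm_leP _ r0) xy i; have := xy i.
  by rewrite !mxE ler_distl => /andP[]; lra.
apply: le_trans (le_lebesgueN sub) _.
apply: le_trans (lebesgueN_box_le _ _) _.
rewrite lee_fin /box_vol (eq_bigr (fun=> 2 * r)); last first.
  move=> i _; rewrite !mxE.
  have -> : x ord0 i + r - (x ord0 i - r) = 2 * r by lra.
  by apply/max_idPl; rewrite mulr_ge0.
by rewrite prodr_const card_ord.
Qed.

Lemma bounded_setPr A : bounded_set A ->
  exists2 r, 0 < r & forall x, A x -> `|x| <= r.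
Proof.
move=> [M [_ HM]]; exists (`|M| + 1) => [|x Ax].
  by rewrite ltr_wpDl.
by apply: (HM (`|M| + 1)) => //; rewrite (le_lt_trans (ler_norm M))// ltrDl.
Qed.

Lemma bounded_lebesgueN_lty A : bounded_set A -> (lebesgueN A < +oo)%E.
Proof.
move=> /bounded_setPr[r r0 Ar].
apply: (@le_lt_trans _ _ (lebesgueN [set y | `|0 - y| <= r]%R)).
  by apply: le_lebesgueN => x /Ar; rewrite /= sub0r normrN.
by apply: le_lt_trans (lebesgueN_ball_le _ (ltW r0)) _; rewrite ltry.
Qed.

(** Boxes are measurable, and [A] is the union of the countably many boxes inside it with rational
    centre and half-width 1/(k+1). *)
Lemma open_lebesgueN_measurable A : open A -> measurable A.
Proof.
move=> oA.
pose B (p : 'rV[rat]_n * nat) : set 'rV[R]_n :=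
  let q : 'rV[R]_n := map_mx ratr p.1 in
  box (q - const_mx p.2.+1%:R^-1) (q + const_mx p.2.+1%:R^-1).
pose D := [set p | B p `<=` A].
have -> : A = \bigcup_(p in D) B p; last first.
  rewrite bigcup_mkcond.
  apply: countable_bigcupT_measurable => [|p]; first exact: countableP.
  by case: ifP => _; [exact: measurable_box|exact: measurable0].
apply/seteqP; split => [x Ax|x [p Dp /Dp//]].
have /nbhs_ballP[e /= e0 xeA] : nbhs x A by exact: open_nbhs_nbhs.
have e2 : 0 < e / 2 by rewrite divr_gt0.
have [k _ /(_ k (leqnn _)) ke] := near_infty_natSinv_lt (PosNum e2).
have k0 : 0 < k.+1%:R^-1 :> R by rewrite invr_gt0.
have /choice[q qx] : forall i, exists q : rat,
    ratr q \in `]x ord0 i, x ord0 i + k.+1%:R^-1[%R.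
  by move=> i; apply: rat_in_itvoo; rewrite ltrDl.
exists (\row_i q i, k); last first.
  move=> i; rewrite !mxE; have := qx i; rewrite in_itv/=.
  by move: (ratr _) _^-1 => a b /andP[? ?]; apply/andP; split; lra.
move=> y /= yB; apply: xeA; rewrite -ball_normE /ball_/=.
apply/mxnorm_ltP => // i; rewrite !mxE ltr_norml.
have := yB i; have := qx i; rewrite !mxE in_itv/=.
by move: ke => /=; move: (ratr _) _^-1 => a b ? /andP[? ?] /andP[? ?]; apply/andP; split; lra.
Qed.

Lemma measurable_coord i : measurable_fun setT (fun x : 'rV[R]_n => x ord0 i).
Proof.
apply: (measurability _ (RGenOInfty.measurableE R)) => _ [_ [c ->] <-].
rewrite setTI (_ : _ @^-1` _ = ~` [set x : 'rV[R]_n | x ord0 i <= c]).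
  by apply: measurableC; exact: lebesgueN_halfspace.
by apply/seteqP; split => x /=; rewrite in_itv/= andbT ltNge => /negP.
Qed.

Lemma measurable_subv i :
  measurable_fun setT (fun z : 'rV[R]_n * 'rV[R]_n => (z.1 - z.2) ord0 i).
Proof.
under eq_fun do rewrite !mxE.
apply: measurable_funB.
  exact: (measurableT_comp (measurable_coord i) measurable_fst).
exact: (measurableT_comp (measurable_coord i) measurable_snd).
Qed.

Lemma measurable_enormB :
  measurable_fun setT (fun z : 'rV[R]_n * 'rV[R]_n => enorm (z.1 - z.2)).
Proof.
have msqrt : measurable_fun setT (@Num.sqrt R).
  by apply: continuous_measurable_fun; exact: sqrt_continuous.
apply: (measurableT_comp msqrt).
apply: measurable_sum => i.
by apply: measurable_funM; exact: measurable_subv.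
Qed.

Lemma measurable_mxnormB_lt t : 0 < t ->
  measurable [set z : 'rV[R]_n * 'rV[R]_n | `|z.1 - z.2| < t].
Proof.
move=> t0.
rewrite [X in measurable X](_ : _ = \bigcap_(i in [set: 'I_n])
    ((fun z : 'rV[R]_n * 'rV[R]_n => (z.1 - z.2) ord0 i) @^-1` `]-t, t[%classic)).
  apply: fin_bigcap_measurable => // i _.
  by rewrite -[X in measurable X]setTI; apply: measurable_subv.
apply/seteqP; split => [z /(mxnorm_ltP _ t0) zt i _/=|z zt /=].
  by rewrite in_itv/= -ltr_norml.
by apply/mxnorm_ltP => // i; rewrite ltr_norml; have := zt i I; rewrite /= in_itv.
Qed.

(* A far translate of A lies in its complement. *)
Lemma bounded_setC_null A : (0 < n)%N -> bounded_set A ->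
  lebesgueN (~` A) = 0%E -> lebesgueN A = 0%E.
Proof.
move=> n0 /bounded_setPr[r r0 Ar] A0; apply/eqP; rewrite eq_le lebesgueN_ge0 andbT.
rewrite -(lebesgueN_shift A (const_mx (3 * r))) -A0.
apply: le_lebesgueN => _ [x Ax <-] /Ar.
have := Ar _ Ax; pose i := Ordinal n0.
move=> /(mxnorm_leP _ (ltW r0)) /(_ i) + /(mxnorm_leP _ (ltW r0)) /(_ i).
by rewrite !mxE !ler_norml => /andP[? ?] /andP[? ?]; lra.
Qed.

End lebesgueN_theory.

(** * Thin layers along a Lipschitz boundary *)

Section boundary_layer.
Context {R : realType} {n : nat}.
Implicit Types (x y z p e : 'rV[R]_n) (r t c d : R) (A B W S : set 'rV[R]_n).

Lemma lebesgueN_preshift A e : lebesgueN [set x | A (x - e)] = lebesgueN A.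
Proof.
rewrite -(lebesgueN_shift A e); congr lebesgueN.
by apply/seteqP; split => [x Ax|_ [x Ax <-]]/=; [exists (x - e); rewrite ?subrK|rewrite addrK].
Qed.

Lemma open_preshift A e : open A -> open [set x | A (x - e)].
Proof.
move=> oA; apply: (@open_comp _ _ (fun x => x - e)) => // x _.
by apply: continuousB => //; exact: cst_continuous.
Qed.

(* The translates of S by the multiples of d *: e are disjoint, and about r / d
   of them fit in a ball of radius comparable to r. *)
Lemma lebesgueN_slab_le S (h : 'rV[R]_n -> R) e p r d :
  open S -> (forall x a, h (x + a *: e) = h x + a) -> `|e| <= 1 ->
  0 < r -> 0 < d -> (forall x, S x -> `|p - x| < r /\ 0 < h x <= d) ->
  (lebesgueN S <= ((2 * (r *+ 2 + d)) ^+ n / r * d)%:E)%E.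
Proof.
move=> oS hD e1 r0 d0 Sh.
(* As [m - 1] is the integer part of [r / d], there are more than [r / d] translates, while the
   largest shift [(m - 1) d] is at most [r]. *)
set m := (Num.truncn (r / d)).+1.
have rd0 : 0 <= r / d by rewrite divr_ge0 ?ltW.
have rm : r / d < m%:R by exact: truncnS_gt.
have mr : (m.-1%:R * d <= r).
  by rewrite -ler_pdivlMr// /m/= truncn_le.
pose F k := [set x | S (x - (k%:R * d) *: e)].
have oF k : open (F k) by exact: open_preshift.
have FS k : lebesgueN (F k) = lebesgueN S by exact: lebesgueN_preshift.
(* On [F k] the height [h] lies in []k d, (k + 1) d]]. *)
have tF : trivIset [set: 'I_m] (fun k : 'I_m => F k).
  apply/trivIsetP => /= i j _ _ ij; rewrite -subset0 => x [/Sh[_ xi] /Sh[_ xj]].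
  exfalso; move: xi; rewrite -scaleNr hD => /andP[i1 i2].
  move: xj; rewrite -scaleNr hD => /andP[j1 j2].
  have : (i < j)%N || (j < i)%N by rewrite -neq_ltn.
  case/orP; rewrite -(ler_nat R) -natr1 => ij'.
    have : (i%:R + 1) * d <= j%:R * d by rewrite ler_wpM2r// ltW.
    by lra.
  have : (j%:R + 1) * d <= i%:R * d by rewrite ler_wpM2r// ltW.
  by lra.
have V0 : 0 <= r *+ 2 + d by rewrite addr_ge0 ?mulrn_wge0 ?ltW.
have : (\sum_(k < m) lebesgueN (F k) <= ((2 * (r *+ 2 + d)) ^+ n)%:E)%E.
  rewrite -(measure_bigsetU_ord _ xpredT _ tF); last first.
    by move=> k; exact: open_lebesgueN_measurable.
  apply: le_trans (lebesgueN_ball_le p V0); apply: le_lebesgueN.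
  rewrite -bigcup_mkord => x [k /= km /Sh[pxk _]].
  have -> : p - x = (p - (x - (k%:R * d) *: e)) - (k%:R * d) *: e.
    by rewrite opprB addrCA addrAC subrr add0r.
  apply: le_trans (ler_normB _ _) _.
  rewrite mulr2n -addrA; apply: lerD; first exact: ltW.
  have kd0 : 0 <= k%:R * d by rewrite mulr_ge0// ltW.
  rewrite normrZ ger0_norm//.
  apply: (@le_trans _ _ (k%:R * d)); first by rewrite ler_piMr.
  apply: (@le_trans _ _ (m.-1%:R * d)); first by rewrite ler_pM2r// ler_nat.
  by rewrite (le_trans mr)// lerDl ltW.
under eq_bigr do rewrite FS.
move=> mS.
have Sfin : lebesgueN S \is a fin_num.
  rewrite ge0_fin_numE ?lebesgueN_ge0//.
  apply: le_lt_trans (ltry ((2 * (r *+ 2 + d)) ^+ n)).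
  apply: le_trans mS; rewrite big_ord_recl leeDl// sume_ge0 //.
rewrite -(fineK Sfin) lee_fin; move: mS; rewrite -(fineK Sfin) sumEFin lee_fin.
have f0 : 0 <= fine (lebesgueN S) by rewrite fine_ge0 ?lebesgueN_ge0.
rewrite sumr_const card_ord -[leLHS]mulr_natl => mS.
rewrite -mulrA mulrC -ler_pdivrMl ?divr_gt0//; last by rewrite mulrC divr_gt0.
rewrite invfM invrK; apply: le_trans mS; rewrite ler_wpM2r//.
exact: ltW.
Qed.

Definition layer W t := W `&` [set x | exists2 y, ~ W y & `|x - y| < t].

Lemma open_layer W t : open W -> open (layer W t).
Proof.
move=> oW; apply: openI => //.
rewrite (_ : [set x | _] = \bigcup_(y in ~` W) ball y t).
  by apply: bigcup_open => y _; exact: ball_open.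
apply/seteqP; split => x [y Wy xy]; exists y => //; move: xy;
  by rewrite -ball_normE /ball_/= distrC.
Qed.

(** Local form of the linear bound on the layer. With its own threshold and constant, it passes to
    finite unions, hence to a compact closure. *)
Definition thin_in W A :=
  exists2 r, 0 < r & exists2 c, 0 <= c &
    forall t, 0 < t -> t <= r -> (lebesgueN (layer W t `&` A) <= (c * t)%:E)%E.

Lemma thin_in_sub W A B : A `<=` B -> thin_in W B -> thin_in W A.
Proof.
move=> AB [r r0 [c c0 H]]; exists r => //; exists c => // t t0 tr.
by apply: le_trans (H t t0 tr); apply: le_lebesgueN; exact: setIS.
Qed.

Lemma thin_in_setU W A B : thin_in W A -> thin_in W B -> thin_in W (A `|` B).
Proof.
move=> [r r0 [c c0 HA]] [r' r'0 [c' c'0 HB]].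
exists (Num.min r r'); first by rewrite lt_min r0.
exists (c + c'); first exact: addr_ge0.
move=> t t0; rewrite le_min => /andP[tr tr'].
rewrite setIUr; apply: le_trans (outer_measureU2 _ _ _) _.
by rewrite mulrDl EFinD leeD ?HA ?HB.
Qed.

Lemma thin_in_set0 W : thin_in W set0.
Proof.
exists 1 => //; exists 0 => // t _ _.
by rewrite setI0 lebesgueN0 mul0r.
Qed.

(** If [ball p e] lies in [W], points of [ball p (e / 2)] are at distance at least [e / 2] from the
    complement, so layers of width at most [e / 2] miss that smaller ball. *)
Lemma thin_in_interior W p : open W -> W p ->
  exists2 r, 0 < r & thin_in W (ball p r).
Proof.
move=> oW Wp.
have /nbhs_ballP[e /= e0 eW] : nbhs p W by exact: open_nbhs_nbhs.
exists (e / 2); first by rewrite divr_gt0.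
exists (e / 2); first by rewrite divr_gt0.
exists 0 => // t t0 te; rewrite mul0r.
rewrite (_ : _ `&` _ = set0) ?lebesgueN0// -subset0.
move=> x [[_ [y Wy xy]] px]; apply: Wy; apply: eW.
by rewrite [e]splitr; apply: ball_triangle px _; rewrite -ball_normE /ball_/=; lra.
Qed.

(* In the chart at p, the height h above the graph is at most a multiple of t
   on the layer, so the layer is covered by a slab. *)
Lemma thin_in_boundary W p : open W -> lipschitz_boundary W -> boundary W p ->
  exists2 r, 0 < r & thin_in W (ball p r).
Proof.
move=> oW lipW /lipW[r0 [L [e [phi [r0_gt0 e1 phiL chart]]]]].
pose N : R := n%:R.
have N0 : 0 <= N by [].
(* The factor [N + 1] passes from the sup norm to the Euclidean norm of the chart and is nonzero
   even for [n = 0]. The factor 4 leaves room for the points [y] of the complement near the ball, at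
   distance less than [2 r] from [p]. *)
pose r := r0 / (N + 1) / 4.
have r_gt0 : 0 < r by rewrite !divr_gt0// ltr_wpDl.
(* The chart allows a negative [L], for instance when the hyperplane is a single point. *)
pose K := Num.max L 0.
have K0 : 0 <= K by rewrite le_max lexx orbT.
have LK : L <= K by rewrite le_max lexx.
(* If [|x - y| < t], then [dotv x e] varies by at most [N t] and the projection [pr x] by at most
   [N (1 + N) t] in Euclidean norm, so [h] varies by at most [(c - 1) t]. The summand 1 keeps [c]
   positive. *)
pose c := 1 + N + K * (N * (1 + N)).
have c0 : 0 < c by rewrite /c -addrA ltr_wpDr// addr_ge0// !mulr_ge0// addr_ge0.
have ne1 : `|e| <= 1 by rewrite -e1 mxnorm_le_enorm.
have dotD x y : dotv (x + y) e = dotv x e + dotv y e.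
  by rewrite /dotv -big_split/=; apply: eq_bigr => i _; rewrite mxE mulrDl.
have dotZ a x : dotv (a *: x) e = a * dotv x e.
  by rewrite /dotv mulr_sumr; apply: eq_bigr => i _; rewrite mxE mulrA.
have dotN x : dotv (- x) e = - dotv x e by rewrite -scaleN1r dotZ mulN1r.
have dote : dotv e e = 1.
  by rewrite -(sqr_sqrtr (dotvv_ge0 e)) -/(enorm e) e1 expr1n.
pose pr x := x - dotv x e *: e.
have dotpr x : dotv (pr x) e = 0 by rewrite dotD dotN dotZ dote mulr1 subrr.
pose h x := dotv x e - phi (pr x).
have hD x a : h (x + a *: e) = h x + a.
  rewrite /h /pr dotD dotZ dote mulr1 scalerDl opprD addrACA subrr addr0.
  by rewrite addrAC.
have chartW x : `|p - x| < r *+ 4 -> W x <-> 0 < h x.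
  move=> px; rewrite subr_gt0; apply: chart.
  apply: le_lt_trans (enorm_le_mxnorm _) _; rewrite distrC in px.
  apply: (@le_lt_trans _ _ ((N + 1) * `|x - p|)); first by rewrite ler_wpM2r// lerDl.
  by rewrite mulrC -ltr_pdivlMr ?ltr_wpDl//; move: px; rewrite /r -[X in _ < X]mulr_natr divfK.
exists r => //; exists r => //.
exists ((2 * (r *+ 2 + c * r)) ^+ n / r * c).
  by rewrite mulr_ge0 ?ltW// divr_gt0// exprn_gt0// mulr_gt0// addr_gt0 ?mulrn_wgt0// mulr_gt0.
move=> t t0 tr.
have ct : 0 < c * t by rewrite mulr_gt0.
apply: le_trans (lebesgueN_slab_le _ hD ne1 r_gt0 ct _) _.
- by apply: openI; [exact: open_layer|exact: ball_open].
- move=> x [[Wx [y Wy xy]]]; rewrite -ball_normE /ball_/= => px.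
  split; [exact: px|apply/andP; split].
    apply/(chartW x) => //; apply: lt_le_trans px _.
    by rewrite mulrS lerDl mulrn_wge0// ltW.
  have hy : h y <= 0.
    rewrite leNgt; apply/negP => hy; apply: Wy; apply/chartW => //.
    have -> : p - y = (p - x) + (x - y) by rewrite addrA subrK.
    apply: le_lt_trans (ler_normD _ _) _.
    have -> : r *+ 4 = r + r + (r + r) by rewrite -!mulr2n -mulrnA.
    by apply: ltr_pwDl => //; lra.
  apply: (@le_trans _ _ (h x - h y)); first by rewrite lerDl oppr_ge0.
  have dxy : `|dotv (x - y) e| <= N * t.
    apply: le_trans (normr_dotv_le _ _) _.
    rewrite -[leRHS]mulr1 ler_pM// ?mulr_ge0// ler_wpM2l//; exact: ltW.
  have prxy : enorm (pr x - pr y) <= N * (t + N * t).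
    apply: le_trans (enorm_le_mxnorm _) _; rewrite ler_wpM2l//.
    have -> : pr x - pr y = (x - y) - dotv (x - y) e *: e.
      by rewrite /pr dotD dotN scalerDl scaleNr !opprD !opprK addrACA.
    apply: le_trans (ler_normB _ _) _; apply: lerD; first exact: ltW.
    rewrite normrZ; apply: le_trans (ler_wpM2l _ ne1) _ => //.
    by rewrite mulr1.
  have := phiL _ _ (dotpr x) (dotpr y).
  have : L * enorm (pr x - pr y) <= K * (N * (t + N * t)).
    apply: (@le_trans _ _ (K * enorm (pr x - pr y))).
      by rewrite ler_wpM2r// enorm_ge0.
    by rewrite ler_wpM2l.
  rewrite ler_distl => + /andP[]; move: dxy; rewrite dotD dotN ler_norml => /andP[].
  rewrite /h (_ : c * t = t + N * t + K * (N * (t + N * t))); last by rewrite /c; lra.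
  by lra.
- rewrite lee_fin mulrA ler_wpM2r//; first exact: ltW.
  rewrite ler_wpM2r//; first exact: ltW.
  rewrite ler_wpM2r ?invr_ge0//; first exact: ltW.
  have s0 : 0 <= 2 * (r *+ 2 + c * t) by rewrite mulr_ge0// addr_ge0 ?mulrn_wge0 ?ltW.
  have st : 2 * (r *+ 2 + c * t) <= 2 * (r *+ 2 + c * r).
    by rewrite ler_wpM2l// lerD2l ler_wpM2l// ltW.
  by rewrite lerXn2r ?nnegrE//; exact: le_trans s0 st.
Qed.

(** Balls with the local bound cover the closure of [W]; by compactness finitely many suffice, which
    settles [t <= r0] for some threshold [r0]. For [t > r0] the measure of [W] itself is at most
    (|W| / r0) t. *)
Lemma lebesgueN_layer_le W : open W -> bounded_set W -> lipschitz_boundary W ->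
  exists2 c, 0 <= c &
    forall t, 0 < t -> (lebesgueN (layer W t) <= (c * t)%:E)%E.
Proof.
move=> oW bW lipW.
have /choice[r rP] : forall p, exists r, 0 < r /\ (closure W p -> thin_in W (ball p r)).
  move=> p; have [cp|ncp] := pselect (closure W p); last by exists 1.
  have [Wp|nWp] := pselect (W p).
    by have [r r0 H] := thin_in_interior oW Wp; exists r.
  have [|r r0 H] := thin_in_boundary oW lipW (p := p); last by exists r.
  by split=> //; rewrite ((interior_id W).1 oW).
have : compact (closure W).
  have [b _ Wb] := bounded_setPr bW.
  pose B := [set x : 'rV[R]_n | `|x| <= b].
  have cB : closed B.
    apply: (@closed_comp _ _ (fun x : 'rV[R]_n => `|x|) [set y | y <= b]).
      by move=> x _; exact: norm_continuous.
    exact: closed_le.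
  apply: (@subclosed_compact _ _ B); first exact: closed_closure.
    apply: bounded_closed_compact => //; exists b; split; first exact: num_real.
    by move=> M bM x /le_trans; apply; exact: ltW.
  by rewrite [B](closure_id B).1//; exact: closure_subset.
rewrite compact_cover => /(_ _ (closure W) (fun p => ball p (r p)))[||D DcW DW].
- by move=> p _; exact: ball_open.
- by move=> p cp; exists p => //; apply: ballxx; exact: (rP p).1.
have thinD (q : seq 'rV[R]_n) : {in q, forall p, closure W p} ->
    thin_in W (\bigcup_(p in [set` q]) ball p (r p)).
  elim: q => [_|p q IH cq].
    by apply: thin_in_sub (thin_in_set0 W) => x [p].
  have thinp := (rP p).2 (cq p (mem_head _ _)).
  apply: thin_in_sub (thin_in_setU thinp (IH _)); last first.
    by move=> y yq; apply: cq; rewrite inE yq orbT.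
  move=> x [y /=]; rewrite inE => /orP[/eqP ->|yq] xy; first by left.
  by right; exists y.
have [r0 r0_gt0 [c c0 H]] : thin_in W W.
  apply: (@thin_in_sub _ _ (\bigcup_(p in [set` finmap.enum_fset D]) ball p (r p))).
    by move=> x Wx; exact/DW/subset_closure.
  by apply: (thinD (finmap.enum_fset D)) => p /DcW; rewrite inE.
have Wfin : lebesgueN W \is a fin_num.
  by rewrite ge0_fin_numE ?lebesgueN_ge0// bounded_lebesgueN_lty.
exists (c + fine (lebesgueN W) / r0).
  by rewrite addr_ge0// divr_ge0 ?fine_ge0 ?lebesgueN_ge0// ltW.
move=> t t0; have [tr|rt] := leP t r0.
  have := H t t0 tr; rewrite setIidl; last by move=> x [].
  move=> /le_trans; apply; rewrite lee_fin ler_pM2r// lerDl.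
  by rewrite divr_ge0 ?fine_ge0 ?lebesgueN_ge0// ltW.
apply: (@le_trans _ _ (lebesgueN W)); first by apply: le_lebesgueN => x [].
rewrite -(fineK Wfin) lee_fin mulrDl -[leLHS]add0r lerD//.
  by rewrite mulr_ge0// ltW.
rewrite mulrAC ler_pdivlMr// ler_wpM2l ?fine_ge0 ?lebesgueN_ge0//; exact: ltW.
Qed.

End boundary_layer.

(** * Integral bounds from countable covers, and dyadic scales *)

Section cover_bound.
Context {R : realType}.

Lemma nneseries_geometric_lty (c q : R) : 0 <= c -> 0 <= q < 1 ->
  (\sum_(0 <= k <oo) (c * q ^+ k)%:E < +oo)%E.
Proof.
move=> c0 /andP[q0 q1].
have cv : cvgn (series (geometric c q)).
  by apply: is_cvg_geometric_series; rewrite ger0_norm.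
have -> : (fun m => \sum_(0 <= k < m) (c * q ^+ k)%:E)%E =
    EFin \o series (geometric c q).
  by apply/funext => m; rewrite /series/= sumEFin.
by rewrite EFin_lim// ltry.
Qed.

(** On [D], [f] is at most the sum of [a k] times the indicator of [F k], which is integrated term
    by term. The sets [F k] may overlap. *)
Lemma integral_le_cover d (T : measurableType d) (mu : {measure set T -> \bar R})
    (D : set T) (f : T -> \bar R) (F : nat -> set T) (a : nat -> R) :
  measurable D -> measurable_fun D f -> (forall x, D x -> (0 <= f x)%E) ->
  (forall k, measurable (F k)) -> D `<=` \bigcup_k F k -> (forall k, 0 <= a k) ->
  (forall k x, D x -> F k x -> (f x <= (a k)%:E)%E) ->
  (\int[mu]_(x in D) f x <= \sum_(0 <= k <oo) ((a k)%:E * mu (F k)))%E.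
Proof.
move=> mD mf f0 mF DF a0 fa.
pose h k x : \bar R := (a k * \1_(F k) x)%:E.
have h0 k x : (0 <= h k x)%E by rewrite lee_fin mulr_ge0.
have mh k : measurable_fun D (h k).
  by apply/measurable_EFinP/measurable_funM => //; exact: measurable_indic.
apply: (@le_trans _ _ (\int[mu]_(x in D) \sum_(0 <= k <oo) h k x)%E).
  apply: ge0_le_integral => //; first exact: ge0_emeasurable_sum.
  move=> x Dx; have [k _ Fkx] := DF _ Dx.
  apply: le_trans (fa _ _ Dx Fkx) _.
  apply: le_trans (nneseries_lim_ge k.+1 _); last by move=> *; exact: h0.
  rewrite big_nat_recr//= -[leLHS]add0e leeD//; first exact: sume_ge0.
  by rewrite /h indicE mem_set// mulr1.
rewrite integral_nneseries//.
apply: lee_nneseries => [k _ _|k _]; first exact: integral_ge0.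
have mI : measurable_fun D (fun x => (\1_(F k) x)%:E : \bar R).
  by apply/measurable_EFinP; exact: measurable_indic.
rewrite /h; under eq_integral do rewrite EFinM.
rewrite ge0_integralZl ?lee_fin//.
rewrite integral_indic// lee_wpmul2l ?lee_fin// le_measure ?inE//.
exact: measurableI.
Qed.

(** The section over [x] has measure at most [c], and is empty unless [x] lies in [L]. *)
Lemma product_measure_le_sections d1 d2 (T1 : measurableType d1)
    (T2 : measurableType d2) (m1 : {sigma_finite_measure set T1 -> \bar R})
    (m2 : {sigma_finite_measure set T2 -> \bar R}) (D : set (T1 * T2))
    (L : set T1) (c : R) :
  measurable D -> measurable L -> 0 <= c -> (forall z, D z -> L z.1) ->
  (forall x, (m2 (xsection D x) <= c%:E)%E) ->
  ((m1 \x m2) D <= c%:E * m1 L)%E.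
Proof.
move=> mD mL c0 DL Dc.
have -> : (c%:E * m1 L = \int[m1]_x (c * \1_L x)%:E)%E.
  have mI : measurable_fun setT (fun x => (\1_L x)%:E : \bar R).
    by apply/measurable_EFinP; exact: measurable_indic.
  under eq_integral do rewrite EFinM.
  rewrite ge0_integralZl ?lee_fin//.
  by rewrite integral_indic// setIT.
rewrite /product_measure1; apply: ge0_le_integral => //.
- exact: measurable_fun_xsection.
- by apply/measurable_EFinP/measurable_funM => //; exact: measurable_indic.
- move=> x _ /=; have [Lx|nLx] := pselect (L x).
    by rewrite indicE mem_set// mulr1.
  rewrite (_ : xsection D x = set0) ?measure0 ?lee_fin ?mulr_ge0//.
  by rewrite -subset0 => y; rewrite /xsection/= inE => /DL.
Qed.

Lemma dyadic_ge1 (d : R) : 1 <= d -> exists k, 2 ^+ k <= d < 2 ^+ k.+1.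
Proof.
move=> d1; have d0 : 0 <= d by exact: le_trans d1.
have m0 : (0 < Num.truncn d)%N by rewrite truncn_gt0.
have /andP[km mk] := trunc_log_bounds (ltnSn 1) m0.
exists (trunc_log 2 (Num.truncn d)); apply/andP; split.
  apply: (@le_trans _ _ (Num.truncn d)%:R); last by rewrite truncn_le.
  by rewrite -natrX ler_nat.
apply: (lt_le_trans (truncnS_gt d)).
by rewrite -natrX ler_nat.
Qed.

(** Apply the previous case to [d^-1]. The factor 2 on the right turns [d <= 2 ^- k] into a strict
    inequality, at the price of overlapping scales. *)
Lemma dyadic_le1 (d : R) : 0 < d -> d <= 1 -> exists k, 2 ^- k.+1 <= d < 2 / 2 ^+ k.
Proof.
move=> d0 d1; have [|k /andP[k1 k2]] := @dyadic_ge1 d^-1; first by rewrite invf_ge1.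
exists k; apply/andP; split.
  by rewrite -[leRHS]invrK lef_pV2 ?posrE ?invr_gt0 ?exprn_gt0// ltW.
apply: (@le_lt_trans _ _ (2 ^- k)).
  by rewrite -[leLHS]invrK lef_pV2 ?posrE ?invr_gt0 ?exprn_gt0.
by rewrite ltr_pMl ?invr_gt0 ?exprn_gt0// ltr1n.
Qed.

End cover_bound.

(** * Finiteness of the fractional perimeter *)

Section fractional_perimeter.
Context {R : realType} {n : nat}.
Implicit Types (W : set 'rV[R]_n) (a s t : R) (z : 'rV[R]_n * 'rV[R]_n).
Local Notation mu := (@lebesgueN R n).

Definition kernel a z : R := (enorm (z.1 - z.2) `^ a)^-1.

Lemma kernel_ge0 a z : 0 <= kernel a z.
Proof. by rewrite invr_ge0 powR_ge0. Qed.

Lemma kernel_swap a z : kernel a (z.2, z.1) = kernel a z.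
Proof. by rewrite /kernel/= -enormN opprB. Qed.

Lemma measurable_kernel a : measurable_fun setT (kernel a).
Proof.
rewrite /kernel; under eq_fun do rewrite -powRN.
exact: (measurableT_comp (measurable_powR (- a)) measurable_enormB).
Qed.

Lemma powRXn (x a : R) k : 0 <= x -> (x ^+ k) `^ a = (x `^ a) ^+ k.
Proof.
move=> x0; elim: k => [|k IH]; first by rewrite !expr0 powR1.
by rewrite !exprS powRM ?exprn_ge0// IH.
Qed.

(** Dyadic scales are taken in the sup norm, which is at most [enorm], so a lower bound on it is
    enough to bound the decreasing kernel. *)
Lemma kernel_le_near a z k : 0 <= a -> 2 ^- k <= `|z.1 - z.2| ->
  kernel a z <= (2 `^ a) ^+ k.
Proof.
move=> a0 kz; rewrite /kernel -[leRHS]invrK lef_pV2 ?posrE; last 2 first.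
- rewrite powR_gt0//; apply: lt_le_trans (mxnorm_le_enorm _).
  by apply: lt_le_trans kz; rewrite invr_gt0 exprn_gt0.
- by rewrite invr_gt0 exprn_gt0// powR_gt0.
rewrite -powRXn// -[leLHS]mul1r ler_pdivrMr ?powR_gt0 ?exprn_gt0//.
have one : 1 = 1 `^ a :> R by rewrite powR1.
rewrite -powRM ?enorm_ge0 ?exprn_ge0// [leLHS]one.
rewrite ge0_ler_powR ?nnegrE ?mulr_ge0 ?enorm_ge0 ?exprn_ge0//.
rewrite -ler_pdivrMr ?exprn_gt0// mul1r.
exact: le_trans (mxnorm_le_enorm _).
Qed.

Lemma kernel_le_far a z k : 0 <= a -> 2 ^+ k <= `|z.1 - z.2| ->
  kernel a z <= ((2 `^ a)^-1) ^+ k.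
Proof.
move=> a0 kz; rewrite /kernel exprVn lef_pV2 ?posrE; last 2 first.
- rewrite powR_gt0//; apply: lt_le_trans (mxnorm_le_enorm _).
  by apply: lt_le_trans kz; rewrite exprn_gt0.
- by rewrite exprn_gt0// powR_gt0.
rewrite -powRXn// ge0_ler_powR ?nnegrE ?enorm_ge0 ?exprn_ge0//.
exact: le_trans (mxnorm_le_enorm _).
Qed.

Lemma product_near_diagonal_le (L : set 'rV[R]_n) t : measurable L -> 0 < t ->
  ((mu \x mu) (L `*` setT `&` [set z | `|z.1 - z.2| < t]%R) <=
     ((2 * t) ^+ n)%:E * mu L)%E.
Proof.
move=> mL t0; apply: product_measure_le_sections => //.
- by apply: measurableI; [exact: measurableX|exact: measurable_mxnormB_lt].
- by rewrite exprn_ge0// mulr_ge0// ltW.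
- by move=> z [[]].
- move=> x; apply: le_trans (lebesgueN_ball_le x (ltW t0)).
  by apply: le_lebesgueN => y; rewrite /xsection/= inE => -[_ /ltW].
Qed.

(** At distance about t = 2^-k, the first point lies in a layer of measure O(t), the second in a
    cube of volume O(t^n), and the kernel is O(t^(-n-s)): the terms are O(t^(1-s)), summable as
    [s < 1]. At distance about 2^k the terms are O(2^(-ks)), summable as [s > 0]. *)
Lemma fractional_perimeter_lty W s : open W -> bounded_set W ->
  lipschitz_boundary W -> 0 < s -> s < 1 ->
  (\int[mu \x mu]_(z in W `*` ~` W) (kernel (n%:R + s) z)%:E < +oo)%E.
Proof.
move=> oW bW lipW s0 s1.
have [c c0 Wc] := lebesgueN_layer_le oW bW lipW.
have mW : measurable W by exact: open_lebesgueN_measurable.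
have Wfin : mu W \is a fin_num.
  by rewrite ge0_fin_numE ?lebesgueN_ge0// bounded_lebesgueN_lty.
set a := n%:R + s; have a0 : 0 <= a by rewrite addr_ge0// ltW.
set q : R := 2 `^ s.
have pow2_gt1 b : 0 < b -> 1 < 2 `^ b :> R.
  move=> b0; have one : 1 = 1 `^ b :> R by rewrite powR1.
  by rewrite [ltLHS]one gt0_ltr_powR ?nnegrE// ltr1n.
have q1 : 1 < q by exact: pow2_gt1.
have q0 : 0 < q by exact: lt_trans q1.
(* The assumption [s < 1] enters here: the ratio [q / 2] of the near series is less than 1. *)
have q2 : q < 2.
  have -> : 2 = 2 `^ (1 - s) * q by rewrite -powRD ?pnatr_eq0 ?implybT// subrK powRr1.
  by rewrite ltr_pMl// pow2_gt1// subr_gt0.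
have Pq : 2 `^ a = 2 ^+ n * q.
  by rewrite /a powRD ?pnatr_eq0 ?implybT// powR_mulrn.
have mk D : measurable_fun D (EFin \o kernel a).
  by apply/measurable_EFinP; exact: measurable_funS (measurable_kernel a).
have mX : measurable (W `*` ~` W).
  by apply: measurableX => //; exact: measurableC.
have mN : measurable [set z : 'rV[R]_n * 'rV[R]_n | `|z.1 - z.2| < 1].
  exact: measurable_mxnormB_lt.
set N := [set z | _] in mN.
rewrite -(setUIDK (W `*` ~` W) N) integral_setU//; last 3 first.
- exact: measurableI.
- exact: measurableD.
- by apply/disj_setPS => z [[_ ?] []].
have pow0 k : (2 ^+ k != 0 :> R) by rewrite expf_neq0.
have qk0 k : q ^+ k != 0 by rewrite expf_neq0// gt_eqF.
have exprC k : 2 ^+ k ^+ n = 2 ^+ n ^+ k :> R by rewrite -!exprM mulnC.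
apply: lte_add_pinfty.
(* Near part: in cell [k] the sup distance lies between 2^-(k+1) and [t k], and the first point lies
   in the layer of width [t k] because the second is outside [W]. *)
- pose t k : R := 2 / 2 ^+ k.
  have t0 k : 0 < t k by rewrite divr_gt0// exprn_gt0.
  pose G k := layer W (t k) `*` setT `&` [set z | `|z.1 - z.2| < t k].
  pose F k := G k `\` [set z | `|z.1 - z.2| < 2 ^- k.+1].
  have mL k : measurable (layer W (t k)) by exact/open_lebesgueN_measurable/open_layer.
  have mG k : measurable (G k).
    by apply: measurableI; [exact: measurableX|exact: measurable_mxnormB_lt].
  have mF k : measurable (F k).
    apply: measurableD => //; apply: measurable_mxnormB_lt.
    by rewrite invr_gt0 exprn_gt0.
  apply: le_lt_trans.
    apply: (@integral_le_cover _ _ _ _ _ _ F (fun k => (2 `^ a) ^+ k.+1)) => //.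
    + exact: measurableI.
    + by move=> z _; rewrite lee_fin kernel_ge0.
    + move=> z [[/= Wz1 Wz2] Nz].
      have d0 : 0 < `|z.1 - z.2|.
        by rewrite normr_gt0 subr_eq0; apply: contra_notN Wz2 => /eqP <-.
      have [k /andP[kz zt]] := dyadic_le1 d0 (ltW Nz).
      exists k => //; split; last by apply/negP; rewrite -leNgt.
      by split=> //; split=> //; split=> //; exists z.2.
    + move=> k z _ [_ /negP]; rewrite -leNgt lee_fin => kz.
      exact: kernel_le_near.
  apply: le_lt_trans (@nneseries_geometric_lty _ (c * 2 * (2 `^ a) * 4 ^+ n) (q / 2) _ _).
  + apply: lee_nneseries => [k _ _|k _].
      by rewrite mule_ge0// lee_fin exprn_ge0// powR_ge0.
    apply: (@le_trans _ _ (((2 `^ a) ^+ k.+1)%:E * (((2 * t k) ^+ n)%:E * (c * t k)%:E))%E).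
      rewrite lee_wpmul2l ?lee_fin ?exprn_ge0 ?powR_ge0//.
      apply: (@le_trans _ _ ((mu \x mu)%E (G k))).
        by apply: le_measure; rewrite ?inE// => z [].
      apply: le_trans (product_near_diagonal_le (mL k) (t0 k)) _.
      by rewrite lee_wpmul2l ?Wc// lee_fin exprn_ge0// mulr_ge0// ltW.
    rewrite lee_fin le_eqVlt; apply/orP; left; apply/eqP.
    have -> : (2 * t k) ^+ n = 4 ^+ n / 2 ^+ n ^+ k.
      by rewrite /t mulrA -natrM expr_div_n exprC.
    rewrite exprS Pq exprMn expr_div_n /t.
    by field; rewrite pow0 expf_neq0.
  + by rewrite !mulr_ge0// ?exprn_ge0// powR_ge0.
  + by rewrite divr_ge0 ?ltW//= ltr_pdivrMr// mul1r.
(* Far part: the first point ranges over [W], of finite measure, and the volume growth 2^(nk)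
   cancels against the kernel, leaving the ratio [q^-1]. *)
- pose G k := W `*` setT `&` [set z : 'rV[R]_n * 'rV[R]_n | `|z.1 - z.2| < 2 ^+ k.+1].
  pose F k := G k `\` [set z | `|z.1 - z.2| < 2 ^+ k].
  have mG k : measurable (G k).
    apply: measurableI; first exact: measurableX.
    by apply: measurable_mxnormB_lt; rewrite exprn_gt0.
  have mF k : measurable (F k).
    by apply: measurableD => //; apply: measurable_mxnormB_lt; rewrite exprn_gt0.
  apply: le_lt_trans.
    apply: (@integral_le_cover _ _ _ _ _ _ F (fun k => (2 `^ a)^-1 ^+ k)) => //.
    + exact: measurableD.
    + by move=> z _; rewrite lee_fin kernel_ge0.
    + move=> z [[/= Wz1 Wz2] /negP]; rewrite -leNgt => Nz.
      have [k /andP[kz zt]] := dyadic_ge1 Nz.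
      by exists k => //; split; last by apply/negP; rewrite -leNgt.
    + move=> k z _ [_ /negP]; rewrite -leNgt lee_fin => kz.
      exact: kernel_le_far.
  apply: le_lt_trans (@nneseries_geometric_lty _ (4 ^+ n * fine (mu W)) (q^-1) _ _).
  + apply: lee_nneseries => [k _ _|k _].
      by rewrite mule_ge0// lee_fin exprn_ge0// invr_ge0 powR_ge0.
    have k0 : 0 < 2 ^+ k.+1 :> R by rewrite exprn_gt0.
    apply: (@le_trans _ _ (((2 `^ a)^-1 ^+ k)%:E * (((2 * 2 ^+ k.+1) ^+ n)%:E * mu W))%E).
      rewrite lee_wpmul2l ?lee_fin ?exprn_ge0 ?invr_ge0 ?powR_ge0//.
      apply: (@le_trans _ _ ((mu \x mu)%E (G k))).
        by apply: le_measure; rewrite ?inE// => z [].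
      exact: product_near_diagonal_le.
    rewrite -[in leLHS](fineK Wfin) lee_fin le_eqVlt; apply/orP; left; apply/eqP.
    have -> : (2 * 2 ^+ k.+1) ^+ n = 4 ^+ n * 2 ^+ n ^+ k :> R.
      by rewrite exprS mulrA -natrM exprMn exprC.
    rewrite Pq !exprVn exprMn.
    by field; rewrite qk0 expf_neq0.
  + by rewrite mulr_ge0 ?exprn_ge0// fine_ge0// lebesgueN_ge0.
  + by rewrite invr_ge0 ltW//= invf_lt1.
Qed.

End fractional_perimeter.

(** * The Gagliardo seminorm and integrability on [Qset W] *)

Section gagliardo_seminorm.
Context {R : realType} {n : nat}.
Implicit Types (W : set 'rV[R]_n) (s K : R) (u v w : 'rV[R]_n -> R)
  (z : 'rV[R]_n * 'rV[R]_n).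
Local Notation mu := (@lebesgueN R n).

Definition increment s u z : R := `|u z.1 - u z.2| * kernel (n%:R + s) z.

Lemma increment_ge0 s u z : 0 <= increment s u z.
Proof. by rewrite mulr_ge0// kernel_ge0. Qed.

Lemma incrementN s u : increment s (\- u) = increment s u.
Proof. by apply/funext => z; rewrite /increment /= -opprD normrN. Qed.

Lemma measurable_diff2 u : measurable_fun setT u ->
  measurable_fun setT (fun z : 'rV[R]_n * 'rV[R]_n => u z.1 - u z.2).
Proof.
move=> mu_; apply: measurable_funB.
  exact: (measurableT_comp mu_ measurable_fst).
exact: (measurableT_comp mu_ measurable_snd).
Qed.

Lemma measurable_increment s u : measurable_fun setT u ->
  measurable_fun setT (increment s u).
Proof.
move=> mu_; apply: measurable_funM; last exact: measurable_kernel.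
exact: measurableT_comp (measurable_diff2 mu_).
Qed.

(** Tonelli turns the iterated integral of [sobolev_Ws1] into one for the product measure, the
    measure used in [energy_gap]. *)
Lemma gagliardo_product W s u : measurable W -> measurable_fun setT u ->
  (\int[mu]_(x in W) \int[mu]_(y in W)
     (`|u x - u y| / enorm (x - y) `^ (n%:R + s))%:E =
   \int[mu \x mu]_(z in W `*` W) (increment s u z)%:E)%E.
Proof.
move=> mW mu_.
have mWW : measurable (W `*` W) by exact: measurableX.
rewrite [RHS]integral_mkcond fubini_tonelli1; last 2 first.
- apply/(measurable_restrictT _ _).1 => //; apply/measurable_EFinP.
  exact: measurable_funS (measurable_increment s mu_).
- by move=> z; rewrite patchE; case: ifP => // _; rewrite lee_fin increment_ge0.
rewrite [LHS]integral_mkcond; apply: eq_integral => x _.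
rewrite patchE /fubini_F; case: ifPn => xW.
  rewrite [LHS]integral_mkcond; apply: eq_integral => y _.
  rewrite !patchE (_ : ((x, y) \in W `*` W) = (y \in W))//.
  apply/idP/idP; rewrite !inE; first by case.
  by move=> yW; split=> //=; exact: set_mem.
rewrite integral0_eq// => y _; rewrite patchE ifF//.
by apply/negP; rewrite inE => -[/mem_set]; rewrite (negbTE xW).
Qed.

(** The pointwise hypothesis covers sums of functions as well as truncations of a difference, so one
    statement serves [psi] and both competitors. *)
Lemma gagliardo_le_lty W s u v w : measurable W ->
  measurable_fun setT u -> measurable_fun setT v -> measurable_fun setT w ->
  (forall x y, `|v x - v y| <= `|u x - u y| + `|w x - w y|) ->
  (\int[mu \x mu]_(z in W `*` W) (increment s u z)%:E < +oo)%E ->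
  (\int[mu \x mu]_(z in W `*` W) (increment s w z)%:E < +oo)%E ->
  (\int[mu \x mu]_(z in W `*` W) (increment s v z)%:E < +oo)%E.
Proof.
move=> mW mu_ mv mw vuw iu iw.
have mWW : measurable (W `*` W) by exact: measurableX.
have mi f : measurable_fun setT f ->
    measurable_fun (W `*` W) (fun z => (increment s f z)%:E : \bar R).
  move=> mf; apply/measurable_EFinP.
  exact: measurable_funS (measurable_increment s mf).
apply: (@le_lt_trans _ _ (\int[mu \x mu]_(z in W `*` W)
    ((increment s u z)%:E + (increment s w z)%:E))%E).
  apply: ge0_le_integral => //.
  - by move=> z _; rewrite lee_fin increment_ge0.
  - exact: mi.
  - by apply: emeasurable_funD; exact: mi.
  - move=> z _; rewrite -EFinD lee_fin -mulrDl.
    by rewrite ler_wpM2r ?kernel_ge0.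
rewrite ge0_integralD//; [|by move=> z _; rewrite lee_fin increment_ge0|exact: mi
  |by move=> z _; rewrite lee_fin increment_ge0|exact: mi].
exact: lte_add_pinfty.
Qed.

Lemma Wspace_le W s u v w : measurable W -> Wspace s W u ->
  measurable_fun setT v -> measurable_fun setT w ->
  lebesgueN.-integrable W (EFin \o v) ->
  (forall x y, `|v x - v y| <= `|u x - u y| + `|w x - w y|) ->
  (\int[mu \x mu]_(z in W `*` W) (increment s w z)%:E < +oo)%E ->
  Wspace s W v.
Proof.
move=> mW [mu_ [_ su]] mv mw iv vuw sw; split; first exact: mv.
split; first exact: iv.
rewrite gagliardo_product; [|exact: mW|exact: mv].
apply: (gagliardo_le_lty mW mu_ mv mw vuw); last exact: sw.
by rewrite -gagliardo_product; [exact: su|exact: mW|exact: mu_].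
Qed.

Lemma measurable_Qset W : measurable W -> measurable (Qset W).
Proof. by move=> mW; apply: measurableC; apply: measurableX; exact: measurableC. Qed.

Lemma QsetE W : Qset W = (W `*` W) `|` ((W `*` ~` W) `|` (~` W `*` W)).
Proof.
apply/seteqP; split => [[x y] nxy|[x y] [[/= Wx _]|[[/= Wx _]|[/= _ Wy]]] []//=].
have [Wx|nWx] := pselect (W x); have [Wy|nWy] := pselect (W y).
- by left.
- by right; left.
- by right; right.
- by exfalso; exact: nxy.
Qed.

Lemma integral_swap (f : 'rV[R]_n * 'rV[R]_n -> \bar R) :
  measurable_fun setT f -> (forall z, (0 <= f z)%E) ->
  (\int[mu \x mu]_z f (z.2, z.1) = \int[mu \x mu]_z f z)%E.
Proof.
move=> mf f0.
rewrite fubini_tonelli1//; last by apply: measurableT_comp => //; exact: measurable_swap.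
by rewrite fubini_tonelli1// /fubini_F/= (fubini_tonelli f).
Qed.

(** Used to carry the perimeter bound from one mixed part of [Qset W] to the other. *)
Lemma integral_swap_setX (A B : set 'rV[R]_n)
    (f : 'rV[R]_n * 'rV[R]_n -> \bar R) :
  measurable A -> measurable B -> measurable_fun setT f ->
  (forall z, f (z.2, z.1) = f z) -> (forall z, (0 <= f z)%E) ->
  (\int[mu \x mu]_(z in B `*` A) f z = \int[mu \x mu]_(z in A `*` B) f z)%E.
Proof.
move=> mA mB mf fC f0.
rewrite [LHS]integral_mkcond [RHS]integral_mkcond -[RHS]integral_swap.
- apply: eq_integral => z _; rewrite !patchE fC.
  by congr (if _ then _ else _); apply/idP/idP; rewrite !inE => -[].
- apply/(measurable_restrictT _ _).1; first exact: measurableX.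
  exact: measurable_funS mf.
- by move=> z; rewrite patchE; case: ifP.
Qed.

(** On pairs inside [W] this is the assumed seminorm bound. On the mixed parts the oscillation bound
    1 reduces the integrand to the kernel, whose integral is the fractional perimeter. *)
Lemma increment_integrable_Qset W s u : open W -> bounded_set W ->
  lipschitz_boundary W -> 0 < s -> s < 1 -> measurable_fun setT u ->
  (forall x y, `|u x - u y| <= 1) ->
  (\int[mu \x mu]_(z in W `*` W) (increment s u z)%:E < +oo)%E ->
  (mu \x mu)%E.-integrable (Qset W) (EFin \o increment s u).
Proof.
move=> oW bW lipW s0 s1 mu_ u1 iu.
have mW : measurable W by exact: open_lebesgueN_measurable.
have mC : measurable (~` W) by exact: measurableC.
have mi D : measurable_fun D (EFin \o increment s u).
  by apply/measurable_EFinP; exact: measurable_funS (measurable_increment s mu_).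
have i0 z : (0 <= (EFin \o increment s u) z)%E by rewrite lee_fin increment_ge0.
have mk D : measurable_fun D (EFin \o @kernel R n (n%:R + s)).
  by apply/measurable_EFinP; exact: measurable_funS (measurable_kernel _).
have ik z : ((EFin \o increment s u) z <= (EFin \o kernel (n%:R + s)) z)%E.
  by rewrite lee_fin ler_piMl ?kernel_ge0.
have per := fractional_perimeter_lty oW bW lipW s0 s1.
have per' : (\int[mu \x mu]_(z in ~` W `*` W) (kernel (n%:R + s) z)%:E < +oo)%E.
  rewrite integral_swap_setX; first exact: per.
  - exact: mW.
  - exact: mC.
  - exact: mk.
  - by move=> z; rewrite kernel_swap.
  - by move=> z; rewrite lee_fin kernel_ge0.
apply/integrableP; split => //.
under eq_integral => z _ do rewrite gee0_abs//.
rewrite QsetE ge0_integral_setU//; last 3 first.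
- exact: measurableX.
- by apply: measurableU; exact: measurableX.
- by apply/disj_setPS => -[x y] [[/= ? ?] [[]|[]]].
apply: lte_add_pinfty => //.
rewrite ge0_integral_setU//; last 3 first.
- exact: measurableX.
- exact: measurableX.
- by apply/disj_setPS => -[x y] [[/= ? ?] []].
apply: lte_add_pinfty.
  by apply: le_lt_trans per; apply: ge0_le_integral => //; exact: measurableX.
by apply: le_lt_trans per'; apply: ge0_le_integral => //; exact: measurableX.
Qed.

End gagliardo_seminorm.

(** * The truncated positive part *)

Section truncation.
Context {R : realType}.
Implicit Types d e : R.

(** The cut at 1 bounds the increments, as integrability across the boundary requires. The factor
    1/2 lets [u] go down and [w] go up by this amount without their slopes crossing. *)
Definition half_trunc d : R := Num.min (Num.max d 0) 1 / 2.

Lemma half_truncE d :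
  half_trunc d = if d <= 0 then 0 else if d <= 1 then d / 2 else 1 / 2.
Proof.
rewrite /half_trunc; case: (leP d 0) => _; first by rewrite min_l ?mul0r.
by case: (leP d 1).
Qed.

Lemma half_trunc_bounds d : 0 <= half_trunc d <= 1 / 2.
Proof.
rewrite half_truncE; case: (leP d 0) => ?; case: (leP d 1) => ?;
  apply/andP; split; lra.
Qed.

Lemma half_trunc_eq0 d : (half_trunc d == 0) = (d <= 0).
Proof.
rewrite half_truncE; case: (leP d 0) => d0; first by rewrite eqxx.
by case: (leP d 1) => d1; apply/eqP; lra.
Qed.

(** The upper bound is the no-crossing condition: twice the shift is at most the difference of the
    arguments. *)
Lemma half_trunc_diff d e : e <= d ->
  0 <= half_trunc d - half_trunc e <= (d - e) / 2.
Proof.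
move=> ed; rewrite !half_truncE.
case: (leP d 0) => ?; case: (leP e 0) => ?; case: (leP d 1) => ?;
  case: (leP e 1) => ?; apply/andP; split; lra.
Qed.

Lemma half_trunc_lipschitz d e : `|half_trunc d - half_trunc e| <= `|d - e|.
Proof.
wlog ed : d e / e <= d.
  by move=> H; have [/H//|/ltW/H] := leP e d; rewrite distrC (distrC e).
have /andP[h0 h1] := half_trunc_diff ed.
by rewrite (ger0_norm h0) ger0_norm ?subr_ge0//; lra.
Qed.

Lemma measurable_half_trunc disp (T : measurableType disp) (f : T -> R) :
  measurable_fun setT f -> measurable_fun setT (half_trunc \o f).
Proof.
move=> mf; apply: measurable_funM => //.
by apply: measurable_minr => //; exact: measurable_maxr.
Qed.

End truncation.

(** * Integrability and sign of the energy gap *)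

Section energy.
Context {R : realType} {n : nat}.
Implicit Types (W : set 'rV[R]_n) (s K : R) (u v w : 'rV[R]_n -> R)
  (z : 'rV[R]_n * 'rV[R]_n) (F : R -> R).
Local Notation mu := (@lebesgueN R n).

Definition slope u z : R := (u z.1 - u z.2) / enorm (z.1 - z.2).

(** For [F = int0 (int0 g)] this is the integrand of [energy_gap]. *)
Definition gap_density F s u v z : R :=
  (F (slope u z) - F (slope v z)) / enorm (z.1 - z.2) `^ (n%:R - 1 + s).

Lemma measurable_slope u : measurable_fun setT u -> measurable_fun setT (slope u).
Proof.
move=> mu_; apply: measurable_funM; first exact: measurable_diff2.
under eq_fun do rewrite -powR_inv1 ?enorm_ge0//.
exact: (measurableT_comp (measurable_powR (- 1)) measurable_enormB).
Qed.

Lemma measurable_gap_density F s u v : continuous F ->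
  measurable_fun setT u -> measurable_fun setT v ->
  measurable_fun setT (gap_density F s u v).
Proof.
move=> cF mu_ mv; apply: measurable_funM; last exact: measurable_kernel.
have mF := continuous_measurable_fun cF.
by apply: measurable_funB; apply: (measurableT_comp mF); exact: measurable_slope.
Qed.

(** The Lipschitz bound on [F] extracts one more factor 1/|x-y| from the slopes, raising the
    exponent from n-1+s to n+s. *)
Lemma gap_density_le F s K u v z : (forall a b, `|F a - F b| <= K * `|a - b|) ->
  `|gap_density F s u v z| <= K * increment s (u \- v) z.
Proof.
move=> FK.
have K0 : 0 <= K.
  by have := le_trans (normr_ge0 _) (FK 1 0); rewrite subr0 normr1 mulr1.
(* On the diagonal both slopes are 0 since [0^-1 = 0], so the left side vanishes. *)
have [z0|z0] := eqVneq (enorm (z.1 - z.2)) 0.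
  rewrite /gap_density /slope z0 invr0 !mulr0 subrr mul0r normr0.
  by rewrite mulr_ge0// increment_ge0.
have d0 : 0 < enorm (z.1 - z.2) by rewrite lt_neqAle eq_sym z0 enorm_ge0.
have powE : enorm (z.1 - z.2) `^ (n%:R + s) =
    enorm (z.1 - z.2) * enorm (z.1 - z.2) `^ (n%:R - 1 + s).
  rewrite -[X in X * _]powRr1 ?enorm_ge0// -powRD ?z0 ?implybT//.
  by congr (_ `^ _); lra.
rewrite /gap_density normrM normfV (ger0_norm (powR_ge0 _ _)).
rewrite /increment /kernel powE invfM !mulrA.
rewrite ler_wpM2r ?invr_ge0 ?powR_ge0//.
apply: le_trans (FK _ _) _; rewrite -mulrA ler_wpM2l//.
rewrite /slope -mulrBl normrM normfV (ger0_norm (enorm_ge0 _)).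
rewrite ler_wpM2r ?invr_ge0 ?enorm_ge0//= le_eqVlt; apply/orP; left; apply/eqP.
by congr `|_|; lra.
Qed.

(** The dominating function depends on [u - v] alone, so the gap is integrable even if each energy
    is infinite. *)
Lemma gap_density_integrable F s K W u v : open W -> bounded_set W ->
  lipschitz_boundary W -> 0 < s -> s < 1 -> continuous F ->
  (forall a b, `|F a - F b| <= K * `|a - b|) ->
  measurable_fun setT u -> measurable_fun setT v ->
  (forall x y, `|(u x - v x) - (u y - v y)| <= 1) ->
  (\int[mu \x mu]_(z in W `*` W) (increment s (u \- v) z)%:E < +oo)%E ->
  (mu \x mu)%E.-integrable (Qset W) (EFin \o gap_density F s u v).
Proof.
move=> oW bW lipW s0 s1 cF FK mu_ mv uv1 iuv.
have mW : measurable W by exact: open_lebesgueN_measurable.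
have mQ := measurable_Qset mW.
have muv : measurable_fun setT (u \- v) by exact: measurable_funB.
have i := increment_integrable_Qset oW bW lipW s0 s1 muv uv1 iuv.
have := integrableZl mQ K i.
apply: le_integrable => //.
  apply/measurable_EFinP; apply: measurable_funS (measurable_gap_density _ cF mu_ mv) => //.
move=> z _; rewrite /= lee_fin; apply: le_trans (gap_density_le _ _ _ _ FK) _.
exact: ler_norm.
Qed.

(* The two competitors u - psi and w + psi pull the slopes of u and w towards
   each other. *)
Lemma gap_density_contraction f s u w z (psi := fun x => half_trunc (u x - w x)) :
  continuous f -> (forall a b, a < b -> f a < f b) ->
  let t := gap_density (int0 f) s u (u \- psi) z +
           gap_density (int0 f) s w (w \+ psi) z in
  0 <= t /\ (psi z.1 != psi z.2 -> 0 < t).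
Proof.
move=> cf incf t.
have [E|nE] := eqVneq (psi z.1) (psi z.2).
  have eu : slope (u \- psi) z = slope u z.
    by rewrite /slope /= E; congr (_ / _); lra.
  have ew : slope (w \+ psi) z = slope w z.
    by rewrite /slope /= E; congr (_ / _); lra.
  by rewrite /t /gap_density eu ew !subrr !mul0r addr0; split=> //; rewrite E eqxx.
suff t0 : 0 < t by split=> [|_ //]; exact: ltW.
have d0 : 0 < enorm (z.1 - z.2).
  rewrite lt_neqAle enorm_ge0 andbT eq_sym enorm_eq0 subr_eq0.
  by apply: contraNN nE => /eqP ->.
rewrite /t /gap_density -mulrDl divr_gt0 ?powR_gt0//.
set d := enorm _ in d0 *.
pose h := (psi z.1 - psi z.2) / d.
have hn0 : h != 0 by rewrite mulf_neq0 ?subr_eq0// invr_eq0 gt_eqF.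
have -> : slope (u \- psi) z = slope u z - h.
  by rewrite /slope /h -/d -mulrBl; congr (_ / _) => /=; lra.
have -> : slope (w \+ psi) z = slope w z + h.
  by rewrite /slope /h -/d -mulrDl; congr (_ / _) => /=; lra.
have [le21|/ltW le12] := leP (u z.2 - w z.2) (u z.1 - w z.1).
  have /andP[h0 h1] := half_trunc_diff le21.
  apply: int0_contraction_gt0 => //; first by rewrite divr_ge0// ltW.
  rewrite /slope -/d -mulrBl mulrA ler_pM2r ?invr_gt0//.
  by rewrite /psi; lra.
(* In the opposite order [h <= 0], and the same inequality applies with the two slopes exchanged and
   [- h] as shift. *)
have /andP[h0 h1] := half_trunc_diff le12.
rewrite addrC -{1}(opprK h) -[X in X - int0 f (slope u z + _)]addr0.
have := @int0_contraction_gt0 R f (slope w z) (slope u z) (- h) cf incf.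
rewrite oppr_eq0 opprK addr0; apply => //.
  by rewrite /h -mulNr opprB divr_ge0// ltW.
have -> : 2 * - h = (2 * (psi z.2 - psi z.1)) / d by rewrite /h; lra.
rewrite /slope -/d -[leRHS]mulrBl ler_pM2r ?invr_gt0//.
by rewrite /psi; lra.
Qed.

End energy.

(** * Comparison of a subminimizer with a superminimizer *)

Theorem proposition2p26 (R : realType) (n : nat) (n_ge1 : (1 <= n)%N)
  (s : R) (s_gt0 : 0 < s) (s_lt1 : s < 1)
  (g : R -> R) (g_gt0 : forall t, 0 < g t) (g_le1 : forall t, g t <= 1)
  (g_even : forall t, g (- t) = g t) (g_cont : continuous g)
  (g_moment : (\int[lebesgue_measure]_t (g t * `|t|)%:E < +oo)%E)
  (Omega : set 'rV[R]_n) (Omega_bounded : bounded_set Omega)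
  (Omega_open : open Omega) (Omega_lipschitz : lipschitz_boundary Omega)
  (u_sub u_super : 'rV[R]_n -> R)
  (sub_min : subminimizer g s Omega u_sub)
  (super_min : superminimizer g s Omega u_super)
  (le_out : {ae lebesgueN, forall x, (~` Omega) x -> u_sub x <= u_super x}) :
  {ae lebesgueN, forall x, u_sub x <= u_super x}.
Proof.
Proof.
(* A bound [K] on [int0 g] is a Lipschitz constant for its primitive. *)
have [K gK] := int0_bounded g_cont (fun t => introT andP (conj (ltW (g_gt0 t)) (g_le1 t))) g_moment.
pose f := int0 g.
have cf : continuous f by exact: continuous_int0.
(* This is the strict convexity of [int0 f]. *)
have incf a b : a < b -> f a < f b by exact: int0_increasing.
have FK a b : `|int0 f a - int0 f b| <= K * `|a - b| by exact: int0_lipschitz.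
have cF : continuous (int0 f) by exact: continuous_int0.
have oW := Omega_open; have mW := open_lebesgueN_measurable oW.
have mC : measurable (~` Omega) by exact: measurableC.
have finW := bounded_lebesgueN_lty Omega_bounded.
case: sub_min => -[mu_ [iu su]] min_u; case: super_min => -[mw [iw sw]] min_w.
set u := u_sub in mu_ iu su min_u le_out *.
set w := u_super in mw iw sw min_w le_out *.
pose psi x := half_trunc (u x - w x).
have psiE x : (psi x == 0) = (u x <= w x) by rewrite half_trunc_eq0 subr_le0.
have psi01 x : 0 <= psi x <= 1 / 2 by exact: half_trunc_bounds.
have mpsi : measurable_fun setT psi.
  by apply: measurable_half_trunc; exact: measurable_funB.
have psi1 x y : `|psi x - psi y| <= 1.
  by rewrite ler_norml; have /andP[? ?] := psi01 x; have /andP[? ?] := psi01 y;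
    apply/andP; split; lra.
have spu := su; rewrite (gagliardo_product s mW mu_) in spu.
have spw := sw; rewrite (gagliardo_product s mW mw) in spw.
have spsi : (\int[lebesgueN \x lebesgueN]_(z in Omega `*` Omega) (increment s psi z)%:E < +oo)%E.
  apply: (gagliardo_le_lty mW mu_ mpsi mw _ spu spw) => x y.
  apply: le_trans (half_trunc_lipschitz _ _) _.
  by rewrite (_ : _ - _ - _ = (u x - u y) - (w x - w y)) ?ler_normB//; lra.
have ipsi : lebesgueN.-integrable Omega (EFin \o psi).
  apply: measurable_bounded_integrable => //; first exact: measurable_funS mpsi.
  exists 1; split; first exact: num_real.
  move=> M M1 x _ /=; have /andP[? ?] := psi01 x.
  by rewrite ger0_norm//; lra.
have Wu : Wspace s Omega (u \- psi).
  have iv : lebesgueN.-integrable Omega (EFin \o (u \- psi)).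
    rewrite (_ : EFin \o _ = ((EFin \o u) \- (EFin \o psi))%E)//.
    exact: integrableB.
  apply: (Wspace_le mW (conj mu_ (conj iu su)) _ mpsi iv _ spsi) => [|x y].
    exact: measurable_funB.
  have -> : (u \- psi) x - (u \- psi) y = (u x - u y) - (psi x - psi y).
    by rewrite /= !opprB addrACA [RHS]addrACA [- u y + _]addrC.
  exact: ler_normB.
have Ww : Wspace s Omega (w \+ psi).
  have iv : lebesgueN.-integrable Omega (EFin \o (w \+ psi)).
    rewrite (_ : EFin \o _ = ((EFin \o w) \+ (EFin \o psi))%E)//.
    exact: integrableD.
  apply: (Wspace_le mW (conj mw (conj iw sw)) _ mpsi iv _ spsi) => [|x y].
    exact: measurable_funD.
  have -> : (w \+ psi) x - (w \+ psi) y = (w x - w y) + (psi x - psi y).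
    by rewrite /= opprD addrACA.
  exact: ler_normD.
pose f1 := gap_density (int0 f) s u (u \- psi).
pose f2 := gap_density (int0 f) s w (w \+ psi).
(* [u - psi] is admissible: [psi = 0] a.e. outside [Omega] by [le_out], and [psi >= 0]. *)
have le1 : (\int[lebesgueN \x lebesgueN]_(z in Qset Omega) (f1 z)%:E <= 0)%E.
  apply: min_u => //.
    apply: filterS le_out => x H /H; rewrite -psiE => /eqP p0.
    by rewrite /= p0 subr0.
  by apply: aeW => x _ /=; rewrite gerBl; have /andP[] := psi01 x.
have le2 : (\int[lebesgueN \x lebesgueN]_(z in Qset Omega) (f2 z)%:E <= 0)%E.
  apply: min_w => //.
    apply: filterS le_out => x H /H; rewrite -psiE => /eqP p0.
    by rewrite /= p0 addr0.
  by apply: aeW => x _ /=; rewrite lerDl; have /andP[] := psi01 x.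
have i1 : (lebesgueN \x lebesgueN)%E.-integrable (Qset Omega) (EFin \o f1).
  have E : u \- (u \- psi) = psi by apply/funext => x /=; rewrite subKr.
  apply: (gap_density_integrable oW Omega_bounded Omega_lipschitz s_gt0 s_lt1 cF FK mu_).
  - exact: measurable_funB.
  - by move=> x y /=; rewrite !subKr; exact: psi1.
  - by rewrite E; exact: spsi.
have i2 : (lebesgueN \x lebesgueN)%E.-integrable (Qset Omega) (EFin \o f2).
  have E : w \- (w \+ psi) = \- psi by apply/funext => x /=; rewrite opprD addNKr.
  apply: (gap_density_integrable oW Omega_bounded Omega_lipschitz s_gt0 s_lt1 cF FK mw).
  - exact: measurable_funD.
  - have Ex x : w x - (w x + psi x) = - psi x by rewrite opprD addNKr.
    by move=> x y; rewrite /= !Ex opprK addrC; exact: psi1.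
  - by rewrite E incrementN; exact: spsi.
have mQ := measurable_Qset mW.
have f12 z := @gap_density_contraction R n f s u w z cf incf.
(* A nonnegative integrand with integral at most 0 vanishes almost everywhere. *)
have ae0 : ae_eq (lebesgueN \x lebesgueN)%E (Qset Omega) (EFin \o (f1 \+ f2)) (cst 0%E).
  have i12 : (lebesgueN \x lebesgueN)%E.-integrable (Qset Omega) (EFin \o (f1 \+ f2)).
    exact: (integrableD mQ i1 i2).
  apply/ae_eq_integral_abs => //; first exact: measurable_int i12.
  apply/eqP; rewrite eq_le integral_ge0// andbT.
  under eq_integral => z _ do rewrite gee0_abs ?lee_fin ?(f12 z).1//.
  have := integralD mQ i1 i2 => /= ->.
  by rewrite -[leRHS]adde0; exact: leeD le1 le2.
(* The product of [A] and [B] lies in [Qset Omega], and [psi] differs at the two points of each of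
   its pairs; so [f1 + f2 > 0] there and the product is null. *)
pose A := Omega `&` [set x | psi x != 0].
pose B := ~` Omega `&` [set x | psi x == 0].
have mpsi0 : measurable [set x | psi x == 0].
  rewrite (_ : [set x | _] = setT `&` psi @^-1` [set 0]); first exact: mpsi.
  by apply/seteqP; split => [x /= /eqP|x /= [_ ->]].
have mA : measurable A.
  apply: measurableI => //; rewrite (_ : [set x | _] = ~` [set x | psi x == 0]).
    exact: measurableC.
  by apply/seteqP; split => x /= /negP.
have mB : measurable B by exact: measurableI.
have AB0 : (lebesgueN A * lebesgueN B = 0)%E.
  have [N [mN N0 subN]] := ae0.
  rewrite -(product_measure1E _ _ mA mB).
  apply/eqP; rewrite eq_le measure_ge0 andbT -N0.
  apply: le_measure; rewrite ?inE//; first exact: measurableX.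
  move=> z [[Oz1 psi1n0] [Oz2 /eqP psi20]]; apply: subN => /= H.
  have ne : psi z.1 != psi z.2 by rewrite psi20.
  have Qz : Qset Omega z by case.
  by have := (f12 z).2 ne; have [->] := H Qz; rewrite ltxx.
have [N [mN N0 leN]] := le_out.
have muA : lebesgueN A = 0%E.
  (* If [B] is null, so is the complement of [Omega], covered by [B] and [N]; as [Omega] is bounded
     and [n >= 1], [Omega] and hence [A] are then null. *)
  move/eqP: AB0; rewrite mule_eq0 => /orP[/eqP //|/eqP B0].
  apply/eqP; rewrite eq_le lebesgueN_ge0 andbT.
  rewrite -(bounded_setC_null n_ge1 Omega_bounded); first by apply: le_lebesgueN => x [].
  apply/eqP; rewrite eq_le lebesgueN_ge0 andbT -[leRHS]adde0 -{1}B0 -N0.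
  apply: le_trans (outer_measureU2 _ _ _); apply: le_lebesgueN => x nOx.
  have [le_x|nle] := boolP (u x <= w x); first by left; split=> //=; rewrite psiE.
  by right; apply: leN => /= H; move/negP: nle; apply; exact: H.
(* Inside [Omega] the inequality fails exactly on [A]; outside, at most on [N]. *)
exists (A `|` N); split.
- exact: measurableU.
- by rewrite measureU0.
- move=> x /= nle; have [Ox|nOx] := pselect (Omega x).
    by left; split=> //=; rewrite psiE; exact/negP.
  by right; apply: leN => /= H; apply: nle; exact: H.
Qed.
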